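(* For every $\varepsilon\in(0,1]$ let $(\eta_{\varepsilon,n},\kappa_{\varepsilon,n})_{n\ge 0}$ be a Markov renewal process on $\mathbb X\times[0,\infty)$, and let $v_{\varepsilon,i}\in[1,\infty)$, $i\in\overline{\mathbb D}$, be normalisation functions. Assume: (A) $F_{\varepsilon,i}(0)<1$ for all $i\in\mathbb X$, $\varepsilon\in(0,1]$. (B) For every $i\in\overline{\mathbb D}$, $j\in\mathbb X$, either $p_{\varepsilon,ij}>0$ for all $\varepsilon\in(0,1]$ or $p_{\varepsilon,ij}=0$ for all $\varepsilon\in(0,1]$; and for every $i\in\overline{\mathbb D}$ there is a chain $i=j_0,j_1,\dots,j_n$ with $j_1,\dots,j_{n-1}\in\overline{\mathbb D}$, $j_n\in\mathbb D$ and $\prod_{l=1}^n p_{1,j_{l-1}j_l}>0$. (C) $p_{\varepsilon,ij}\to p_{0,ij}$ as $\varepsilon\to0$, for $i\in\overline{\mathbb D}$, $j\in\mathbb X$. (D) For $i\in\overline{\mathbb D}$, $j\in\mathbb Y_{1,i}$: $F_{\varepsilon,ij}(\cdot\, v_{\varepsilon,i})\Rightarrow F_{0,ij}(\cdot)$ as $\varepsilon\to0$, where $F_{0,ij}$ is a proper distribution function with $F_{0,ij}(0)<1$; and $v_{\varepsilon,i}\to v_{0,i}\in[1,\infty]$. (E) For $i\in\overline{\mathbb D}$, $j\in\mathbb Y_{1,i}$: $e_{\varepsilon,ij}<\infty$ for all $\varepsilon\in(0,1]$ and $e_{\varepsilon,ij}/v_{\varepsilon,i}\to e_{0,ij}=\int_0^\infty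 t\,F_{0,ij}(dt)<\infty$ as $\varepsilon\to0$. Let $k_1,\dots,k_{\bar m}$ be an enumeration of $\overline{\mathbb D}$ and assume, with the level-$n$ quantities defined in the context, that as $\varepsilon\to0$: (i) $\tilde p^{(n)}_{\varepsilon,ij}\to\tilde p^{(n)}_{0,ij}\in[0,1]$ for $i\in\overline{\mathbb D}_n$, $j\in\mathbb X_n$, $n=0,\dots,\bar m-1$; (ii) $\hat q^{(n)}_{\varepsilon,ij}\to\hat q^{(n)}_{0,ij}\in[0,1]$ for $i\in\overline{\mathbb D}_n$, $j\in\mathbb Y^{(n)}_i$, $n=1,\dots,\bar m-1$; (iii) $\tilde v^{(n-1)}_{\varepsilon,j}/\tilde v^{(n-1)}_{\varepsilon,i}\to\tilde w^{(n-1)}_{0,ji}\in[0,\infty]$ for $i,j\in\overline{\mathbb D}_{n-1}$, $n=1,\dots,\bar m-1$; (iv) $\tilde w^{(n-1)}_{0,k_ni}<\infty$ for all $i\in\overline{\mathbb D}_{n-1}$, $n=1,\dots,\bar m-1$. Then, for every $j\in\mathbb D$, with $\bar v_{\varepsilon,k_{\bar m}}=\tilde v^{(\bar m-1)}_{\varepsilon,k_{\bar m}}$, $$\frac{E_{\varepsilon,\mathbb D,k_{\bar m}j}}{\bar v_{\varepsilon,k_{\bar m}}}\to \bar E_{0,\mathbb D,k_{\bar m}j}=\tilde e^{(\bar m-1)}_{0,k_{\bar m}j}\;\tilde p^{(\bar m-1)}_{0,k_{\bar m}j}<\infty\quad\text{as }\varepsilon\to0$$ (the limit is $0$ if $j\notin\tilde{\mathbb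 Y}^{(\bar m-1)}_{k_{\bar m}}$), and this limit equals $E_{0,\mathbb D,k_{\bar m}j}=\int_0^\infty t\,G_{0,\mathbb D,k_{\bar m}j}(dt)$, where $G_{0,\mathbb D,k_{\bar m}j}$ is the (possibly improper) distribution function with Laplace transform $\tilde\phi^{(\bar m-1)}_{0,k_{\bar m}j}(s)\,\tilde p^{(\bar m-1)}_{0,k_{\bar m}j}$.
   Context: $\mathbb X=\{1,\dots,M\}$, $M\ge2$; $\mathbb D$ is a nonempty proper subset of $\mathbb X$, $\overline{\mathbb D}=\mathbb X\setminus\mathbb D$, $\bar m=|\overline{\mathbb D}|\ge1$. For each $\varepsilon\in(0,1]$, a Markov renewal process $(\eta_{\varepsilon,n},\kappa_{\varepsilon,n})_{n\ge0}$ is a homogeneous Markov chain on $\mathbb X\times[0,\infty)$ whose transition probabilities $Q_{\varepsilon,ij}(t)=\mathsf P\{\eta_{\varepsilon,1}=j,\kappa_{\varepsilon,1}\le t\mid\eta_{\varepsilon,0}=i,\kappa_{\varepsilon,0}=s\}$ do not depend on $s$. Notation: $p_{\varepsilon,ij}=Q_{\varepsilon,ij}(\infty)$; $F_{\varepsilon,i}(t)=\sum_jQ_{\varepsilon,ij}(t)$; $F_{\varepsilon,ij}=Q_{\varepsilon,ij}/p_{\varepsilon,ij}$ if $p_{\varepsilon,ij}>0$; $e_{\varepsilon,ij}=\int_0^\infty tF_{\varepsilon,ij}(dt)$; $\mathbb Y_{1,i}=\{j\in\mathbb X:p_{1,ij}>0\}$; $\phi_{0,ij}(s)=\int_0^\infty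 e^{-st}F_{0,ij}(dt)$; $\Rightarrow$ is weak convergence of distribution functions. Hitting times: $\nu_{\varepsilon,\mathbb D}=\min(n\ge1:\eta_{\varepsilon,n}\in\mathbb D)$, $\tau_{\varepsilon,\mathbb D}=\sum_{n=1}^{\nu_{\varepsilon,\mathbb D}}\kappa_{\varepsilon,n}$, $E_{\varepsilon,\mathbb D,ij}=\mathsf E\{\tau_{\varepsilon,\mathbb D}\,\mathrm I(\eta_{\varepsilon,\nu_{\varepsilon,\mathbb D}}=j)\mid\eta_{\varepsilon,0}=i\}$. Level-$n$ quantities (for a given enumeration $k_1,\dots,k_{\bar m}$ of $\overline{\mathbb D}$). $\mathbb X_n=\mathbb X\setminus\{k_1,\dots,k_n\}$, $\overline{\mathbb D}_n=\overline{\mathbb D}\setminus\{k_1,\dots,k_n\}$, $0\le n\le\bar m-1$. For $\varepsilon\in(0,1]$, $i\in\overline{\mathbb D}_n$, $j\in\mathbb X_n$: $p^{(0)}_{\varepsilon,ij}=p_{\varepsilon,ij}$, $v^{(0)}_{\varepsilon,i}=v_{\varepsilon,i}$, $$\tilde p^{(n)}_{\varepsilon,ij}=\mathrm I(j\ne i)\frac{p^{(n)}_{\varepsilon,ij}}{1-p^{(n)}_{\varepsilon,ii}},\quad \tilde v^{(n)}_{\varepsilon,i}=\frac{v^{(n)}_{\varepsilon,i}}{1-p^{(n)}_{\varepsilon,ii}},\quad p^{(n)}_{\varepsilon,ij}=\tilde p^{(n-1)}_{\varepsilon,ij}+\tilde p^{(n-1)}_{\varepsilon,ik_n}\tilde p^{(n-1)}_{\varepsilon,k_nj},\quad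 v^{(n)}_{\varepsilon,i}=\tilde v^{(n-1)}_{\varepsilon,i}\quad(n\ge1).$$ (Condition (B) implies $p^{(n)}_{\varepsilon,ii}<1$ for $\varepsilon\in(0,1]$.) $\mathbb Y^{(n)}_i=\{j\in\mathbb X_n:p^{(n)}_{1,ij}>0\}$, $\tilde{\mathbb Y}^{(n)}_i=\mathbb Y^{(n)}_i\setminus\{i\}$; for $n\ge1$ and $j\in\mathbb Y^{(n)}_i$, $\hat q^{(n)}_{\varepsilon,ij}=\tilde p^{(n-1)}_{\varepsilon,ij}/p^{(n)}_{\varepsilon,ij}$. $p^{(n)}_{0,ij}=\lim_{\varepsilon\to0}p^{(n)}_{\varepsilon,ij}$, i.e. $p^{(0)}_{0,ij}=p_{0,ij}$ and $p^{(n)}_{0,ij}=\tilde p^{(n-1)}_{0,ij}+\tilde p^{(n-1)}_{0,ik_n}\tilde p^{(n-1)}_{0,k_nj}$. Limiting Laplace transforms and expectations: $\phi^{(0)}_{0,ij}=\phi_{0,ij}$, $e^{(0)}_{0,ij}=e_{0,ij}$. For $i\in\overline{\mathbb D}_n$, $j\in\tilde{\mathbb Y}^{(n)}_i$, writing $p=p^{(n)}_{0,ii}$, $$\tilde\phi^{(n)}_{0,ij}(s)=\begin{cases}\phi^{(n)}_{0,ij}(s),& i\notin\mathbb Y^{(n)}_i,\\ \frac{(1-p)\phi^{(n)}_{0,ij}((1-p)s)}{1-p\,\phi^{(n)}_{0,ii}((1-p)s)},& i\in\mathbb Y^{(n)}_i,\ p<1,\\ (1+e^{(n)}_{0,ii}s)^{-1},&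 p=1,\end{cases}\qquad\tilde e^{(n)}_{0,ij}=\begin{cases}e^{(n)}_{0,ij},& i\notin\mathbb Y^{(n)}_i,\\(1-p)e^{(n)}_{0,ij}+p\,e^{(n)}_{0,ii},& i\in\mathbb Y^{(n)}_i.\end{cases}$$ For $n\ge1$, $i\in\overline{\mathbb D}_n$, $j\in\mathbb Y^{(n)}_i$, writing $k=k_n$, $w=\tilde w^{(n-1)}_{0,k_ni}$, $q=\hat q^{(n)}_{0,ij}$, and $\tilde\phi,\tilde e,\tilde{\mathbb Y}$ for the level $n-1$ objects $\tilde\phi^{(n-1)}_0,\tilde e^{(n-1)}_0,\tilde{\mathbb Y}^{(n-1)}$: (a) if $j,k\in\tilde{\mathbb Y}_i$ and $j\in\tilde{\mathbb Y}_k$: $\phi^{(n)}_{0,ij}(s)=q\tilde\phi_{ij}(s)+(1-q)\tilde\phi_{ik}(s)\tilde\phi_{kj}(ws)$, $e^{(n)}_{0,ij}=q\tilde e_{ij}+(1-q)(\tilde e_{ik}+w\tilde e_{kj})$; (b) if $j\in\tilde{\mathbb Y}_i$ and ($k\notin\tilde{\mathbb Y}_i$ or $j\notin\tilde{\mathbb Y}_k$): $\phi^{(n)}_{0,ij}=\tilde\phi_{ij}$, $e^{(n)}_{0,ij}=\tilde e_{ij}$; (c) if $j\notin\tilde{\mathbb Y}_i$ (in particular $j=i$): $\phi^{(n)}_{0,ij}(s)=\tilde\phi_{ik}(s)\tilde\phi_{kj}(ws)$, $e^{(n)}_{0,ij}=\tilde e_{ik}+w\tilde e_{kj}$. *)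

(* Defs.v *)
From HB Require Import structures.
From mathcomp Require Import all_boot all_order all_algebra.
From mathcomp Require Import all_classical all_reals all_analysis.

Set Implicit Arguments.
Unset Strict Implicit.
Unset Printing Implicit Defensive.
Import Order.TTheory GRing.Theory Num.Theory.
Import numFieldNormedType.Exports.

Local Open Scope ring_scope.

Section DistributionFunctions.
Local Open Scope classical_set_scope.
Context {R : realType}.

Definition df_mean (F : cumulative R R) : \bar R :=
  (\int[lebesgue_stieltjes_measure F]_(t in `[0%R, +oo[) t%:E)%E.

Definition df_laplace (F : cumulative R R) (s : R) : \bar R :=
  (\int[lebesgue_stieltjes_measure F]_(t in `[0%R, +oo[) (expR (- s * t))%:E)%E.

Definition possibly_improper_df (G : R -> R) : Prop :=
  (forall t, t < 0 -> G t = 0) /\ (forall t, G t <= 1).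

Definition weak_cvg_df (F : R -> R -> R) (G : R -> R) : Prop :=
  forall t, {for t, continuous G} -> F eps t @[eps --> 0^'+] --> G t.

End DistributionFunctions.

Section MarkovRenewalProcesses.
Local Open Scope classical_set_scope.

(* The sigma-algebra generated by the pairs (eta_m, kappa_m), m <= n. *)
Definition history d (T : measurableType d) (R : realType) (M : nat)
    (eta : nat -> T -> 'I_M) (kappa : nat -> T -> R) (n : nat) : set (set T) :=
  <<s [set A | exists2 m, (m <= n)%N &
         (exists l, A = eta m @^-1` [set l]) \/
         (exists2 B, measurable B & A = kappa m @^-1` B)] >>.

(* [mr_prob i] is the law P{ . | eta_0 = i}.  States are the elements of 'I_M.
   In [mr_markov] the law of (eta_n.+1, kappa_n.+1) given the past depends on
   it only through eta_n, hence not on the value of kappa_n. *)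
Record markov_renewal (R : realType) (M : nat) := MarkovRenewal {
  mr_display : measure_display ;
  mr_space : measurableType mr_display ;
  mr_prob : 'I_M -> probability mr_space R ;
  mr_eta : nat -> mr_space -> 'I_M ;
  mr_kappa : nat -> mr_space -> R ;
  mr_eta_measurable : forall n l, measurable (mr_eta n @^-1` [set l]) ;
  mr_kappa_measurable : forall n, measurable_fun setT (mr_kappa n) ;
  mr_kappa_ge0 : forall n w, 0 <= mr_kappa n w ;
  mr_start : forall i, mr_prob i (mr_eta 0 @^-1` [set i]) = 1%E ;
  mr_markov : forall i n A l j t, history mr_eta mr_kappa n A ->
    mr_prob i (A `&` mr_eta n @^-1` [set l] `&`
               [set w | mr_eta n.+1 w = j /\ mr_kappa n.+1 w <= t]) =
    (mr_prob i (A `&` mr_eta n @^-1` [set l]) *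
     mr_prob l [set w | mr_eta 1 w = j /\ (mr_kappa 1 w <= t)%R])%E }.

Context {R : realType} {M : nat}.
Implicit Types (X : markov_renewal R M) (i j : 'I_M) (t : R).

Definition mr_Q X i j t : R :=
  fine (mr_prob X i [set w | mr_eta 1 w = j /\ mr_kappa 1 w <= t]).

(* Q_ij(oo) *)
Definition mr_p X i j : R := fine (mr_prob X i [set w | mr_eta 1 w = j]).

Definition mr_F X i t : R := \sum_j mr_Q X i j t.

(* Only meaningful when 0 < mr_p X i j; it is the zero function otherwise. *)
Definition mr_Fij X i j t : R := mr_Q X i j t / mr_p X i j.

Lemma mr_Q_measurable X j t :
  measurable [set w : mr_space X | mr_eta 1 w = j /\ mr_kappa 1 w <= t].
Proof.
rewrite (_ : [set _ | _] = mr_eta (m := X) 1 @^-1` [set j] `&`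
  (setT `&` mr_kappa (m := X) 1 @^-1` `]-oo, t])); last first.
  by apply/seteqP; split=> w /=; rewrite in_itv/=; [move=> [? ?] | move=> [? [_ ?]]].
apply: measurableI; first exact: mr_eta_measurable.
by apply: mr_kappa_measurable.
Qed.

Lemma mr_Q_nd X i j : nondecreasing_fun (mr_Q X i j).
Proof.
move=> s t st; apply: fine_le; rewrite ?fin_num_measure//;
  try exact: mr_Q_measurable.
apply: le_measure; rewrite ?inE; try exact: mr_Q_measurable.
by move=> w /= [-> ks]; split=> //; exact: le_trans st.
Qed.

Lemma mr_Q_rc X i j : right_continuous (mr_Q X i j).
Proof.
move=> a.
have Q0 t : 0 <= mr_Q X i j t by exact: fine_ge0.
have [l Ql] : exists l : R, mr_Q X i j r @[r --> a^'+] --> l.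
  eexists; apply: (@nondecreasing_at_right_cvgr _ _ _ (BLeft (a + 1)%R)).
  - by rewrite bnd_simp ltrDl.
  - by move=> x y _ _; exact: mr_Q_nd.
  - by exists 0 => _ [x _ <-]; exact: Q0.
have Qn : mr_Q X i j (a + n.+1%:R^-1) @[n --> \oo] --> l.
  move/cvg_at_rightP : Ql; apply; split=> [n|]; rewrite ?ltrDl //.
  rewrite -[X in _ --> X]addr0; apply: (@cvgD _ R^o); first exact: cvg_cst.
  by rewrite gtr0_cvgV0 ?cvg_shiftS; [exact: cvgr_idn | near=> n].
suff Qa : mr_Q X i j (a + n.+1%:R^-1) @[n --> \oo] --> mr_Q X i j a.
  by rewrite -(cvg_unique _ Qn Qa).
apply: fine_cvg; rewrite fineK ?fin_num_measure//; last exact: mr_Q_measurable.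
pose F n := [set w : mr_space X |
  mr_eta 1 w = j /\ mr_kappa 1 w <= a + n.+1%:R^-1].
have FE : \bigcap_n F n = [set w | mr_eta 1 w = j /\ mr_kappa 1 w <= a].
  apply/seteqP; split=> w /=; last first.
    by move=> [wj wa] n _; split=> //; rewrite ler_wpDr.
  move=> Fw; split; first by have [] := Fw 0%N I.
  have : (\bigcap_n `]-oo, (a + n.+1%:R^-1)%R]%classic) (mr_kappa 1 w).
    by move=> n _; have [_] := Fw n I; rewrite /= in_itv.
  by rewrite -itvNycEbigcap /= in_itv.
rewrite -FE; apply: nonincreasing_cvg_mu => [| | |m n mn].
- by rewrite -ge0_fin_numE// fin_num_measure//; exact: mr_Q_measurable.
- by move=> n; exact: mr_Q_measurable.
- by apply: bigcap_measurable => // n _; exact: mr_Q_measurable.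
- apply/subsetPset => w [/= wj wm]; split => //; apply: le_trans wm _.
  by rewrite lerD2l lef_pV2 ?posrE// ler_nat.
Unshelve. all: by end_near. Qed.

Lemma mr_Fij_nd X i j : nondecreasing_fun (mr_Fij X i j).
Proof.
by move=> s t st; rewrite ler_wpM2r ?invr_ge0 ?fine_ge0//; exact: mr_Q_nd.
Qed.

Lemma mr_Fij_rc X i j : right_continuous (mr_Fij X i j).
Proof. by move=> a; apply: cvgMl; exact: mr_Q_rc. Qed.

HB.instance Definition _ X i j :=
  isCumulative.Build R _ R (mr_Fij X i j) (@mr_Fij_nd X i j) (@mr_Fij_rc X i j).

Definition mr_e X i j : \bar R := df_mean (mr_Fij X i j).

(* min (n >= 1 : eta_n \in D); None stands for oo *)
Definition mr_nu X (D : {set 'I_M}) (w : mr_space X) : option nat :=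
  if pselect (exists n, (0 < n)%N && (mr_eta n w \in D)) is left h
  then Some (ex_minn h) else None.

Definition mr_E X (D : {set 'I_M}) i j : \bar R :=
  (\int[mr_prob X i]_w
     (if mr_nu D w is Some nu
      then (\sum_(1 <= n < nu.+1) mr_kappa n w) * (mr_eta nu w == j)%:R
      else 0%R)%:E)%E.

End MarkovRenewalProcesses.

Section Levels.
Context {R : realType} {M : nat}.
Variable k : nat -> 'I_M.   (* k_1, k_2, ...; k 0 is not used *)
Implicit Types (i j : 'I_M) (n : nat) (p : 'I_M -> 'I_M -> R).

Definition enumeration_of (A : {set 'I_M}) : Prop :=
  perm_eq [seq k n | n <- iota 1 #|A|] (enum A).

Definition Xlev n : {set 'I_M} := [set i | i \notin [seq k l | l <- iota 1 n]]%SET.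

Definition Dbarlev (D : {set 'I_M}) n : {set 'I_M} := (Xlev n :\: D)%SET.

(* Below, functions of states are total; level-n objects are only meaningful
   for i in Dbarlev D n and j in Xlev n (and j in Ylev or Ytilde where required). *)

Definition remove_loop p i j : R := (j != i)%:R * (p i j / (1 - p i i)).

Fixpoint plev p n i j : R :=
  if n is m.+1 then
    remove_loop (plev p m) i j +
    remove_loop (plev p m) i (k n) * remove_loop (plev p m) (k n) j
  else p i j.

Definition ptilde p n := remove_loop (plev p n).

Fixpoint vlev p (v : 'I_M -> R) n i : R :=
  if n is m.+1 then vlev p v m i / (1 - plev p m i i) else v i.

Definition vtilde p (v : 'I_M -> R) n i : R := vlev p v n i / (1 - plev p n i i).

Definition qhat p n i j : R := ptilde p n.-1 i j / plev p n i j.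

(* In the next two definitions p1 is the matrix (p_{1,ij}), i.e. epsilon = 1. *)
Definition Ylev (p1 : 'I_M -> 'I_M -> R) n i : {set 'I_M} :=
  [set j in Xlev n | 0 < plev p1 n i j]%SET.

Definition Ytilde (p1 : 'I_M -> 'I_M -> R) n i : {set 'I_M} :=
  (Ylev p1 n i :\ i)%SET.

(* Limiting objects: pt0, qh0, w0 are the limits of ptilde, qhat and of the
   ratios of the vtilde. *)
Variables (p1 p0 : 'I_M -> 'I_M -> R).
Variables (pt0 qh0 : nat -> 'I_M -> 'I_M -> R).
Variable w0 : nat -> 'I_M -> 'I_M -> \bar R.

Definition p0lev n i j : R :=
  if n is m.+1 then pt0 m i j + pt0 m i (k n) * pt0 m (k n) j else p0 i j.

Definition loop_e n (e : 'I_M -> 'I_M -> R) i j : R :=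
  if i \notin Ylev p1 n i then e i j
  else (1 - p0lev n i i) * e i j + p0lev n i i * e i i.

Definition loop_phi n (e : 'I_M -> 'I_M -> R) (phi : 'I_M -> 'I_M -> R -> R)
    i j (s : R) : R :=
  let p := p0lev n i i in
  if i \notin Ylev p1 n i then phi i j s
  else if p < 1 then
    (1 - p) * phi i j ((1 - p) * s) / (1 - p * phi i i ((1 - p) * s))
  else (1 + e i i * s)^-1.

(* From level n-1 (with loops removed) to level n >= 1. *)
Definition step_e n (et : 'I_M -> 'I_M -> R) i j : R :=
  let Yt := Ytilde p1 n.-1 in
  let w := fine (w0 n.-1 (k n) i) in
  let q := qh0 n i j in
  if j \in Yt i then
    if (k n \in Yt i) && (j \in Yt (k n))
    then q * et i j + (1 - q) * (et i (k n) + w * et (k n) j)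
    else et i j
  else et i (k n) + w * et (k n) j.

Definition step_phi n (phit : 'I_M -> 'I_M -> R -> R) i j (s : R) : R :=
  let Yt := Ytilde p1 n.-1 in
  let w := fine (w0 n.-1 (k n) i) in
  let q := qh0 n i j in
  if j \in Yt i then
    if (k n \in Yt i) && (j \in Yt (k n))
    then q * phit i j s + (1 - q) * (phit i (k n) s * phit (k n) j (w * s))
    else phit i j s
  else phit i (k n) s * phit (k n) j (w * s).

Variable F0 : 'I_M -> 'I_M -> cumulativeBounded (0 : R) (1 : R).

Fixpoint e0lev n : 'I_M -> 'I_M -> R :=
  if n is m.+1 then step_e n (loop_e m (e0lev m))
  else fun i j => fine (df_mean (F0 i j)).

Definition etilde0 n := loop_e n (e0lev n).

Fixpoint phi0lev n : 'I_M -> 'I_M -> R -> R :=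
  if n is m.+1 then step_phi n (loop_phi m (e0lev m) (phi0lev m))
  else fun i j s => fine (df_laplace (F0 i j) s).

Definition phitilde0 n := loop_phi n (e0lev n) (phi0lev n).

End Levels.

(* Main.v *)
Require Import Defs.
From HB Require Import structures.
From mathcomp Require Import all_boot all_order all_algebra.
From mathcomp Require Import all_classical all_reals all_analysis.
From mathcomp Require Import measurable_realfun ring lra.
Import Order.TTheory GRing.Theory Num.Theory.
Import numFieldNormedType.Exports.

Local Open Scope classical_set_scope.
Local Open Scope ring_scope.

(** For fixed [eps], the Markov property turns [E_{D,ij}] into a series whose
    sum is [y i], where [h i = P_i (exit at j)] and [y] solve the linear systems
    [h = P h + p_j] and [y = K h + K_j + P y], [K] being the matrix of the means
    [p_ij e_ij].  Removing loops and eliminating the states [k_1, k_2, ...] one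
    at a time is Gaussian elimination on these systems: besides [p^(n)] it
    produces matrices [K^(n)] with the same solution [y], and at the last level
    [y (k_mbar)] is a single entry of the loop-free [K].  The quotients
    [K^(n)_ij / (p^(n)_ij v^(n)_i)] satisfy recursions whose limits are those
    defining [e^(n)_{0,ij}].

    On the limiting side, [phi^(n)_{0,ij}] is the Laplace transform of a
    distribution on [0, oo[ with mean [e^(n)_{0,ij}], because such transforms are
    closed under mixtures, products, scaling and geometric compounding, and
    contain the exponential laws.  The mean is the limit of [(1 - phi s) / s] at
    [0+], so it is determined by the transform alone. *)

(** The limiting chain cannot be handled directly: p^(n)_{0,ii} may equal 1, so its linear systems
    may be singular, and weak convergence alone does not control means. Hence the elimination is
    exact at each fixed eps, where (B) keeps the systems nonsingular and the supports independent of
    eps, and only normalised quotients pass to the limit. Removing the loop at i divides p^(n)_ij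
    v^(n)_i by (1 - p^(n)_ii)^2, which matches the singular factor of the mean, so the quotient
    stays bounded even when p^(n)_ii tends to 1.

    The transforms phi^(n)_0 are never obtained as limits. Two separate inductions follow the
    recursion of e^(n)_0: one shows that it is the limit of the quotients, the other that it is the
    mean attached to phi^(n)_0. *)

(** * Restricted laws and Stieltjes measures *)

Lemma ge0_integral_mrestr d (T : measurableType d) (R : realType)
    (mu : {measure set T -> \bar R}) (A : set T) (mA : measurable A)
    (f : T -> \bar R) : measurable_fun setT f -> (forall x, 0 <= f x)%E ->
  (\int[mrestr mu mA]_x f x = \int[mu]_(x in A) f x)%E.
Proof.
move=> mf f0; rewrite -(setUv A) ge0_integral_setU//=; first last.
- by apply/disj_set2P; rewrite setICr.
- by rewrite setUv.
- exact: measurableC.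
rewrite [X in (_ + X)%E](_ : _ = 0%E) ?adde0; last first.
  apply: null_set_integral; first exact: measurableC.
    exact: measurable_funTS.
  by rewrite /= /mrestr setICl measure0.
by apply: eq_measure_integral => B mB BA /=; rewrite /mrestr setIidl.
Qed.

(** Change of variables when the law of f on A is c times nu. Since f is nonnegative this law lives
    on [[0, +oo[], the domain of integration in [df_mean]. *)
Lemma ge0_integral_law d (T : measurableType d) (R : realType)
    (mu : {measure set T -> \bar R}) (A : set T) (mA : measurable A)
    (f : T -> R) (c : R) (nu : {measure set (measurableTypeR R) -> \bar R}) :
  measurable_fun setT f -> (forall x, 0 <= f x) -> 0 <= c ->
  (forall Y : set R, measurable Y -> mu (A `&` f @^-1` Y) = c%:E * nu Y)%E ->
  (\int[mu]_(x in A) (f x)%:E = c%:E * \int[nu]_(t in `[0%R, +oo[) t%:E)%E.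
Proof.
move=> mf f0 c0 munu.
have mEf : measurable_fun setT (EFin \o f) by exact/measurable_EFinP.
rewrite -(@ge0_integral_mrestr _ _ _ mu A mA (EFin \o f)) => [|//|]; last first.
  by move=> x; rewrite lee_fin.
have fT : f @^-1` `[0, +oo[ = setT.
  by apply/seteqP; split => // x _ /=; rewrite in_itv/= f0.
pose f' : T -> measurableTypeR R := f.
transitivity (\int[pushforward (mrestr mu mA) f']_(t in `[0%R, +oo[) t%:E)%E.
  rewrite (@ge0_integral_pushforward _ _ _ (measurableTypeR R) _ f')//= ?fT//.
  by move=> y; rewrite inE/= in_itv/= andbT lee_fin.
pose c' : {nonneg R} := NngNum c0.
transitivity (\int[mscale c' nu]_(t in `[0%R, +oo[) t%:E)%E.
  apply: eq_measure_integral => Y mY _ /=.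
  by rewrite /pushforward /mrestr /mscale/= setIC munu.
rewrite ge0_integral_mscale//.
by move=> t /=; rewrite in_itv/= andbT lee_fin.
Qed.

(** Multiples of a cumulative function describe laws on an event of probability below 1 and, later,
    the improper G. *)
Definition scaled_df (R : realType) (c : {nonneg R}) (F : R -> R) : R -> R :=
  fun t => c%:num * F t.

Lemma scaled_df_nd (R : realType) (c : {nonneg R}) (F : cumulative R R) :
  nondecreasing_fun (scaled_df _ c F).
Proof. by move=> s t st; rewrite ler_wpM2l//; exact: cumulative_is_nondecreasing. Qed.

Lemma scaled_df_rc (R : realType) (c : {nonneg R}) (F : cumulative R R) :
  right_continuous (scaled_df _ c F).
Proof.
by move=> a; apply: cvgMl_tmp; exact: cumulative_is_right_continuous.
Qed.

HB.instance Definition _ (R : realType) (c : {nonneg R}) (F : cumulative R R) :=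
  isCumulative.Build R _ R (scaled_df _ c F) (@scaled_df_nd R c F) (@scaled_df_rc R c F).

Lemma lebesgue_stieltjes_itv (R : realType) (F : cumulative R R) (a b : R) :
  a <= b -> lebesgue_stieltjes_measure F `]a, b] = (F b - F a)%:E.
Proof.
move=> ab; rewrite /lebesgue_stieltjes_measure /measure_extension/=.
rewrite measurable_mu_extE/=; last exact: is_ocitv.
by rewrite wlength_itv_bnd.
Qed.

Lemma lebesgue_stieltjes_scaled_df (R : realType) (c : {nonneg R})
    (F : cumulative R R) (A : set (measurableTypeR R)) : measurable A ->
  (lebesgue_stieltjes_measure (scaled_df _ c F) A =
   c%:num%:E * lebesgue_stieltjes_measure F A)%E.
Proof.
move=> mA.
rewrite (@lebesgue_stieltjes_measure_unique R _ (mscale c (lebesgue_stieltjes_measure F)))//.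
move=> I [[a b]]/= _ <-; rewrite /mscale.
have [ab | ba] := leP a b; last first.
  by rewrite set_itv_ge ?measure0 ?mule0// bnd_simp -leNgt ltW.
rewrite lebesgue_stieltjes_itv//= (lebesgue_stieltjes_itv _ F)//.
by rewrite -[RHS]EFinM/= /scaled_df mulrBr.
Qed.

(** Half-open intervals are differences of half-lines, and the measure is finite on half-lines, so
    it can be subtracted there. *)
Lemma lebesgue_stieltjes_of_halfline (R : realType) (F : cumulative R R)
    (nu : {measure set (measurableTypeR R) -> \bar R}) :
  (forall t : R, nu `]-oo, t]%classic = (F t)%:E) ->
  forall A, measurable A -> lebesgue_stieltjes_measure F A = nu A.
Proof.
move=> nuF; apply: lebesgue_stieltjes_measure_unique => I [[a b]]/= _ <-.
have [ab | ba] := leP a b; last first.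
  by rewrite set_itv_ge ?measure0// bnd_simp -leNgt ltW.
rewrite lebesgue_stieltjes_itv//.
have -> : `]a, b]%classic = `]-oo, b] `\` `]-oo, a].
  by rewrite -[RHS]setCK setCD setCitvl setUC -[LHS]setCK setCitv.
rewrite measureD//; last by rewrite [X in (X < _)%E](nuF b) ltry.
rewrite setIidr; last exact: subset_itvl.
by rewrite [X in (X - _)%E](nuF b) [X in (_ - X)%E](nuF a) EFinB.
Qed.

Lemma probability_df (R : realType) (P : probability (measurableTypeR R) R) :
  exists G : cumulative R R,
    (forall A, measurable A -> lebesgue_stieltjes_measure G A = P A) /\
    (forall t : R, G t = fine (P `]-oo, t]%classic)).
Proof.
eexists; split; first exact: lebesgue_stieltjes_cdf_id.
by [].
Qed.

(** * Gaussian elimination for substochastic systems *)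

Section Elimination.
Context {R : realType} {M : nat}.
Implicit Types (p a : 'I_M -> 'I_M -> R) (B Z : {set 'I_M}) (i j l : 'I_M).

(* The last clause says that no nonempty subset of B is closed under p. *)
Definition transient B Z p : Prop :=
  [/\ B \subset Z,
      (forall i j, i \in B -> j \in Z -> 0 <= p i j),
      (forall i, i \in B -> \sum_(j in Z) p i j <= 1) &
      (forall S : {set 'I_M}, S \subset B -> S != finset.set0 ->
         exists i j, [/\ i \in S, j \in Z, j \notin S & 0 < p i j])].

(** The Schur complement of 1 - p at c when p c c = 0, which holds once loops are removed. *)
Definition eliminate (c : 'I_M) p i j : R := p i j + p i c * p c j.

Lemma transient_le1 B Z p i j : transient B Z p -> i \in B -> j \in Z -> p i j <= 1.
Proof.
move=> [_ p0 ps _] iB jZ; apply: le_trans (ps _ iB).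
by rewrite (bigD1 j)//= lerDl sumr_ge0// => l /andP[lZ _]; exact: p0.
Qed.

(** The singleton of i is not closed, so positive mass goes from i to another state. *)
Lemma transient_loop_lt1 B Z p i : transient B Z p -> i \in B -> p i i < 1.
Proof.
move=> [/fintype.subsetP BZ p0 ps pe] iB.
have [||i' [j [/finset.set1P -> jZ]]] := pe [set i]%SET.
- by rewrite finset.sub1set.
- by apply/finset.set0Pn; exists i; rewrite finset.set11.
rewrite inE => ji pij.
apply: lt_le_trans (ps _ iB).
rewrite (bigD1 i) ?BZ//= ltrDl (bigD1 j)/=; last by rewrite jZ.
by rewrite ltr_pwDl// sumr_ge0// => l /andP[/andP[lZ _] _]; exact: p0.
Qed.

Lemma remove_loop_diag p i : remove_loop p i i = 0.
Proof. by rewrite /remove_loop eqxx mul0r. Qed.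

Lemma remove_loopE p i j : j != i -> remove_loop p i j = p i j / (1 - p i i).
Proof. by move=> ji; rewrite /remove_loop ji mul1r. Qed.

(** An edge that leaves a set S is not a loop, hence it survives with a positive weight. *)
Lemma transient_remove_loop B Z p : transient B Z p -> transient B Z (remove_loop p).
Proof.
move=> tp; have [BZ p0 ps pe] := tp.
have p1 i : i \in B -> 0 < 1 - p i i.
  by move=> iB; rewrite subr_gt0; exact: transient_loop_lt1 tp iB.
have r0 i j : i \in B -> j \in Z -> 0 <= remove_loop p i j.
  by move=> iB jZ; rewrite !mulr_ge0 ?p0// invr_ge0 ltW// p1.
split=> //.
- move=> i iB; rewrite (bigD1 i)/= ?(fintype.subsetP BZ)// remove_loop_diag add0r.
  under eq_bigr => j /andP[_ ji] do rewrite remove_loopE//.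
  rewrite -mulr_suml ler_pdivrMr ?p1// mul1r lerBrDl.
  by have := ps _ iB; rewrite (bigD1 i)/= ?(fintype.subsetP BZ).
- move=> S SB S0; have [i [j [iS jZ jS pij]]] := pe _ SB S0.
  exists i, j; split => //; rewrite remove_loopE; last first.
    by apply: contraNneq jS => ->.
  by rewrite divr_gt0// p1//; exact: (fintype.subsetP SB).
Qed.

Lemma transient_eliminate B Z p c : transient B Z p -> c \in B ->
  transient (B :\ c) (Z :\ c) (eliminate c p).
Proof.
move=> [BZ p0 ps pe] cB; have cZ := fintype.subsetP BZ _ cB.
have e0 i j : i \in B -> j \in Z -> 0 <= p i c * p c j.
  by move=> iB jZ; rewrite mulr_ge0 ?p0.
split.
- exact: finset.setSD.
- move=> i j /finset.setD1P[_ iB] /finset.setD1P[_ jZ].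
  by rewrite addr_ge0 ?p0 ?e0.
- move=> i /finset.setD1P[_ iB]; rewrite big_split/= -mulr_sumr.
  have := ps _ iB; rewrite (big_setD1 c cZ)/=; apply: le_trans.
  rewrite addrC lerD2r ler_piMr ?p0//.
  by have := ps _ cB; rewrite (big_setD1 c cZ)/=; have := p0 c c cB cZ; lra.
- move=> S SB S0.
  have SB' : S \subset B by apply: fintype.subset_trans SB (finset.subsetDl _ _).
  have cS : c \notin S.
    by apply/negP => /(fintype.subsetP SB); rewrite !inE eqxx.
  have [i [j [iS jZ jS pij]]] := pe _ SB' S0.
  have iB := fintype.subsetP SB' _ iS.
  have [jc|jc] := eqVneq j c; last first.
    exists i, j; split => //; first by rewrite !inE jc.
    by rewrite ltr_pwDl// e0.
  subst j.
  (* The edge found above goes from i in S to the eliminated c. An edge leaving c |: S starts either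
     at c, and then i -> c -> j escapes from S, or in S, and then it is itself the escape. *)
  have [||i' [j [i'S jZ' jS' pij']]] := pe (c |: S)%SET.
  - by rewrite finset.subUset finset.sub1set cB.
  - by apply/finset.set0Pn; exists c; rewrite finset.setU11.
  have /andP[jc jS'' ] : (j != c) && (j \notin S).
    by move: jS'; rewrite !inE negb_or.
  have jZc : j \in (Z :\ c)%SET by rewrite !inE jc.
  case/finset.setU1P : i'S => [i'c|i'S].
    subst i'; exists i, j; split => //.
    by rewrite ltr_wpDl ?mulr_gt0// p0.
  exists i', j; split => //; rewrite ltr_pwDl// e0//.
  exact: (fintype.subsetP SB').
Qed.

(** Minimum principle: if u had a negative minimum m on B, the set where it is attained would be
    closed under p. Leaving that set means reaching a larger value in B or leaving B, where u counts
    as 0 > m. *)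
Lemma transient_min_principle B Z p (u : 'I_M -> R) : transient B Z p ->
  (forall i, i \in B -> \sum_(l in B) p i l * u l <= u i) ->
  forall i, i \in B -> 0 <= u i.
Proof.
move=> [BZ p0 ps pe] hu i1 i1B; rewrite leNgt; apply/negP => ui1.
have [i0 i0B i0min] : exists2 i0, i0 \in B & forall l, l \in B -> u i0 <= u l.
  by have [i0 ? ?] := Order.TotalTheory.arg_minP u i1B; exists i0.
set m := u i0 in i0min.
have m0 : m < 0 by apply: le_lt_trans ui1; exact: i0min.
have [||i [j [iS jZ jS pij]]] := pe [set i in B | u i == m]%SET.
- by apply/fintype.subsetP => l; rewrite inE => /andP[].
- by apply/finset.set0Pn; exists i0; rewrite inE i0B eqxx.
move: iS; rewrite inE => /andP[iB /eqP uim].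
have := hu _ iB; rewrite uim leNgt => /negP; apply.
(* Centring at m separates the two sources of strictness: a step to a larger value makes the first
   sum positive, and a step out of B makes the mass multiplying m < 0 smaller than 1. *)
have -> : \sum_(l in B) p i l * u l =
    \sum_(l in B) p i l * (u l - m) + (\sum_(l in B) p i l) * m.
  by rewrite mulr_suml -big_split/=; apply: eq_bigr => l _; ring.
have t0 l : l \in B -> 0 <= p i l * (u l - m).
  by move=> lB; rewrite mulr_ge0 ?p0 ?(fintype.subsetP BZ)// subr_ge0 i0min.
have := ps _ iB; rewrite (big_setID B)/= (finset.setIidPr BZ) => psB.
have rest0 : 0 <= \sum_(l in (Z :\: B)%SET) p i l.
  by rewrite sumr_ge0// => l /finset.setDP[lZ _]; exact: p0.
have [jB|jB] := boolP (j \in B).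
  have tj : 0 < p i j * (u j - m).
    rewrite mulr_gt0// subr_gt0 lt_neqAle i0min// andbT eq_sym.
    by move: jS; rewrite inE jB.
  rewrite (bigD1 j)//=.
  have : 0 <= \sum_(l in B | l != j) p i l * (u l - m).
    by rewrite sumr_ge0// => l /andP[lB _]; exact: t0.
  by nra.
have : 0 <= \sum_(l in B) p i l * (u l - m) by exact: sumr_ge0.
have : p i j <= \sum_(l in (Z :\: B)%SET) p i l.
  rewrite (bigD1 j)/=; last by rewrite !inE jB.
  by rewrite lerDl sumr_ge0// => l /andP[/finset.setDP[lZ _] _]; exact: p0.
by nra.
Qed.

(** The block of p on B is extended by zero to a full square matrix A. The minimum principle for w
    and for -w shows that w = A w has only the zero solution, so 1 - A is invertible; applied once
    more, it gives the sign of y. *)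
Lemma transient_solve B Z p (b : 'I_M -> R) : transient B Z p ->
  exists y : 'I_M -> R,
    (forall i, i \in B -> y i = b i + \sum_(l in B) p i l * y l) /\
    ((forall i, i \in B -> 0 <= b i) -> forall i, i \in B -> 0 <= y i).
Proof.
move=> tp.
pose A := (\matrix_(i, l) (((i \in B) && (l \in B))%:R * p i l)) : 'M[R]_M.
have AE (w : 'cV[R]_M) i : (A *m w) i 0 =
    if i \in B then \sum_(l in B) p i l * w l 0 else 0.
  rewrite mxE; case: ifPn => iB; last first.
    by rewrite big1// => l _; rewrite mxE (negbTE iB)/= !mul0r.
  rewrite [RHS]big_mkcond/=; apply: eq_bigr => l _; rewrite mxE iB/=.
  by case: (l \in B); rewrite ?mul1r ?mul0r.
have injA (w : 'cV[R]_M) : w = A *m w -> w = 0.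
  move=> wE; apply/colP => i; rewrite [RHS]mxE.
  have [iB|iB] := boolP (i \in B); last by rewrite wE AE (negbTE iB).
  have wEi l : l \in B -> w l 0 = \sum_(r in B) p l r * w r 0.
    by move=> lB; rewrite {1}wE AE lB.
  apply/le_anti/andP; split.
    rewrite -oppr_ge0.
    apply: (@transient_min_principle B Z p (fun l => - w l 0) tp) => // l lB.
    under eq_bigr do rewrite mulrN.
    by rewrite sumrN -wEi.
  apply: (@transient_min_principle B Z p (fun l => w l 0) tp) => // l lB.
  by rewrite -wEi.
have uA : 1%:M - A \in unitmx.
  (* [kermx] is a left kernel, while injectivity was shown on columns; hence the transpose. *)
  rewrite -unitmx_tr -row_free_unit -kermx_eq0; apply/rowV0P => w /sub_kermxP.
  move=> /(congr1 trmx); rewrite trmx_mul trmxK trmx0 mulmxBl mul1mx => /eqP.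
  rewrite subr_eq0 => /eqP /injA /(congr1 trmx).
  by rewrite trmxK trmx0.
pose w : 'cV[R]_M := invmx (1%:M - A) *m (\col_i b i).
have wE : w = \col_i b i + A *m w.
  have : (1%:M - A) *m w = \col_i b i by rewrite /w mulKVmx.
  by rewrite mulmxBl mul1mx => <-; rewrite subrK.
have wEi i : i \in B -> w i 0 = b i + \sum_(l in B) p i l * w l 0.
  by move=> iB; rewrite {1}wE mxE mxE AE iB.
exists (fun i => w i 0); split => // b0.
apply: (@transient_min_principle B Z p (fun l => w l 0) tp) => // i iB.
by rewrite wEi// lerDr b0.
Qed.

(** Summing over the number n of loops, the sum of p_ii^n a_ij + n p_ii^(n-1) a_ii p_ij.
    Equivalently, the derivative of [remove_loop] at p in the direction a. *)
Definition loop_mean p a i j : R :=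
  (j != i)%:R * (a i j / (1 - p i i) + p i j * a i i / (1 - p i i) ^+ 2).

(** Likewise the derivative of [eliminate] at p in the direction a, by the product rule. *)
Definition eliminate_mean (c : 'I_M) p a i j : R :=
  a i j + a i c * p c j + p i c * a c j.

(* Equations of [h i = P_i (exit at j)] and [y i = E_i (time; exit at j)] for
   a chain with transition matrix p and mean step times [a i j = E_i (time; next = j)]. *)
Definition exit_system B p a j (h y : 'I_M -> R) : Prop :=
  forall i, i \in B ->
    h i = \sum_(l in B) p i l * h l + p i j /\
    y i = \sum_(l in B) a i l * h l + a i j + \sum_(l in B) p i l * y l.

(** Row i is solved for its diagonal unknowns; the other rows are not touched. *)
Lemma exit_system_loop B p a j h y : j \notin B ->
  (forall i, i \in B -> p i i < 1) ->
  exit_system B p a j h y ->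
  exit_system B (remove_loop p) (loop_mean p a) j h y.
Proof.
move=> jB p1 sys i iB.
have [] := sys _ iB; rewrite !(bigD1 (P := mem B) i iB)/=.
have ji : j != i by apply: contraNneq jB => ->.
have lii : loop_mean p a i i = 0 by rewrite /loop_mean eqxx mul0r.
have lij : loop_mean p a i j = a i j / (1 - p i i) + p i j * a i i / (1 - p i i) ^+ 2.
  by rewrite /loop_mean ji mul1r.
rewrite remove_loop_diag lii lij !mul0r !add0r remove_loopE//.
have d0 : 1 - p i i != 0 by rewrite subr_eq0 eq_sym lt_eqF// p1.
set d := 1 - p i i in d0 *.
have -> : \sum_(l in B | l != i) remove_loop p i l * h l =
    (\sum_(l in B | l != i) p i l * h l) / d.
  rewrite mulr_suml; apply: eq_bigr => l /andP[_ li].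
  by rewrite remove_loopE// mulrAC.
have -> : \sum_(l in B | l != i) remove_loop p i l * y l =
    (\sum_(l in B | l != i) p i l * y l) / d.
  rewrite mulr_suml; apply: eq_bigr => l /andP[_ li].
  by rewrite remove_loopE// mulrAC.
have -> : \sum_(l in B | l != i) loop_mean p a i l * h l =
    (\sum_(l in B | l != i) a i l * h l) / d +
    (\sum_(l in B | l != i) p i l * h l) * (a i i / d ^+ 2).
  rewrite !mulr_suml -big_split/=; apply: eq_bigr => l /andP[_ li].
  by rewrite /loop_mean li mul1r -/d; ring.
set sa := \sum_(l in B | _) a i l * h l.
set sp := \sum_(l in B | _) p i l * h l.
set sy := \sum_(l in B | _) p i l * y l.
move=> hE yE.
have hd : h i * d = sp + p i j by rewrite mulrBr mulr1 {1}hE; ring.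
have yd : y i * d = a i i * h i + sa + a i j + sy.
  by rewrite mulrBr mulr1 {1}yE; ring.
split; first by rewrite -mulrDl -hd mulfK.
(* The row of y contains a i i * h i; replacing h i by its own solved row produces the square in
   [loop_mean]. *)
have hE' : h i = (sp + p i j) / d by rewrite -hd mulfK.
rewrite -(mulfK d0 (y i)) yd hE'.
by field.
Qed.

Lemma exit_system_eliminate B p a c j h y : c \in B ->
  p c c = 0 -> a c c = 0 ->
  exit_system B p a j h y ->
  exit_system (B :\ c) (eliminate c p) (eliminate_mean c p a) j h y.
Proof.
move=> cB pcc acc sys i /finset.setD1P[ic iB].
have [] := sys _ iB; have [] := sys _ cB.
rewrite !(big_setD1 c cB)/= pcc acc !mul0r !add0r => hc yc hi yi.
have -> : \sum_(l in (B :\ c)%SET) eliminate c p i l * h l =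
   \sum_(l in (B :\ c)%SET) p i l * h l +
   p i c * \sum_(l in (B :\ c)%SET) p c l * h l.
  by rewrite mulr_sumr -big_split; apply: eq_bigr => l _; rewrite /eliminate/=; ring.
have -> : \sum_(l in (B :\ c)%SET) eliminate c p i l * y l =
   \sum_(l in (B :\ c)%SET) p i l * y l +
   p i c * \sum_(l in (B :\ c)%SET) p c l * y l.
  by rewrite mulr_sumr -big_split; apply: eq_bigr => l _; rewrite /eliminate/=; ring.
have -> : \sum_(l in (B :\ c)%SET) eliminate_mean c p a i l * h l =
   \sum_(l in (B :\ c)%SET) a i l * h l +
   a i c * (\sum_(l in (B :\ c)%SET) p c l * h l) +
   p i c * \sum_(l in (B :\ c)%SET) a c l * h l.
  rewrite !mulr_sumr -!big_split; apply: eq_bigr => l _.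
  by rewrite /eliminate_mean/=; ring.
rewrite hi yi yc hc /eliminate /eliminate_mean; split; ring.
Qed.

End Elimination.

(** * The mean exit time as the sum of a series *)

Section ExitSeries.
Context {R : realType} {M : nat}.
Variables (B Z : {set 'I_M}) (p K : 'I_M -> 'I_M -> R) (i : 'I_M).
Implicit Types (j l r : 'I_M) (n : nat).

(* For a chain started at i: the probability of being at l at time n after
   staying in B before n, and the mean time elapsed on that event. *)
Fixpoint occupation n l : R :=
  if n is m.+1 then \sum_(r in B) occupation m r * p r l else (l == i)%:R.

Fixpoint elapsed n l : R :=
  if n is m.+1 then
    \sum_(r in B) (elapsed m r * p r l + occupation m r * K r l)
  else 0.

(** For (u, z) = (h, y) this is the mean total time on the event that the exit at j comes after time
    n: time already elapsed, weighted by h, plus time still to come. *)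
Let pairing n (u z : 'I_M -> R) : R :=
  \sum_(r in B) (elapsed n r * u r + occupation n r * z r).

(** Duality: [elapsed] and [occupation] advance by the adjoint of the operators acting on (u, z), so
    exchanging the two sums turns the equations of (u, z) into one step of time. *)
Lemma pairing_step n (b b' u z : 'I_M -> R) :
  (forall r, r \in B -> u r = b r + \sum_(l in B) p r l * u l) ->
  (forall r, r \in B -> z r = b' r + \sum_(l in B) K r l * u l +
                              \sum_(l in B) p r l * z l) ->
  pairing n u z = \sum_(r in B) (elapsed n r * b r + occupation n r * b' r) +
                  pairing n.+1 u z.
Proof.
move=> uE zE.
have -> : pairing n.+1 u z =
    \sum_(r in B) (elapsed n r * (\sum_(l in B) p r l * u l) +
      occupation n r * (\sum_(l in B) K r l * u l) +
      occupation n r * (\sum_(l in B) p r l * z l)).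
  rewrite /pairing /=.
  under eq_bigr do rewrite !mulr_suml -big_split/=.
  rewrite exchange_big/=; apply: eq_bigr => r rB.
  rewrite !mulr_sumr -!big_split/=; apply: eq_bigr => l lB.
  by ring.
rewrite -big_split/=; apply: eq_bigr => r rB; rewrite uE// zE//.
by ring.
Qed.

Hypotheses (tp : transient B Z p) (iB : i \in B).
Hypothesis K0 : forall r l, r \in B -> l \in Z -> 0 <= K r l.

Lemma occupation_ge0 n l : l \in Z -> 0 <= occupation n l.
Proof.
have [BZ p0 _ _] := tp.
elim: n l => [|n ih] l lZ /=; first exact: ler0n.
by rewrite sumr_ge0// => r rB; rewrite mulr_ge0 ?p0// ih// (fintype.subsetP BZ).
Qed.

Lemma elapsed_ge0 n l : l \in Z -> 0 <= elapsed n l.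
Proof.
have [BZ p0 _ _] := tp.
elim: n l => [//|n ih] l lZ /=.
rewrite sumr_ge0// => r rB; have rZ := fintype.subsetP BZ _ rB.
by rewrite addr_ge0// mulr_ge0 ?p0 ?ih ?K0// occupation_ge0.
Qed.

(* The pairing with the solution of [g = 1 + P g] and [z = 1 + K g + P z] is a
   nonnegative sequence whose decrements are the terms below. *)
Lemma elapsed_occupation_cvg0 :
  \sum_(r in B) (elapsed n r + occupation n r) @[n --> \oo] --> (0 : R).
Proof.
have [BZ p0 _ _] := tp.
have inZ r : r \in B -> r \in Z by move/(fintype.subsetP BZ).
have [g [gE g0]] := transient_solve B Z p (fun=> 1) tp.
have {}g0 := g0 (fun _ _ => ler01).
have [z [zE z0]] := transient_solve B Z p
  (fun r => 1 + \sum_(l in B) K r l * g l) tp.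
have {}z0 r : r \in B -> 0 <= z r.
  apply: z0 => {}r rB; rewrite addr_ge0// sumr_ge0// => l lB.
  by rewrite mulr_ge0 ?K0 ?g0 ?inZ.
pose Phi n := pairing n g z.
have Phi_ge0 n : 0 <= Phi n.
  rewrite sumr_ge0// => r rB.
  by rewrite addr_ge0// mulr_ge0 ?g0 ?z0 ?elapsed_ge0 ?occupation_ge0 ?inZ.
have PhiE n : Phi n - Phi n.+1 = \sum_(r in B) (elapsed n r + occupation n r).
  rewrite /Phi (@pairing_step n (fun=> 1) (fun=> 1) g z gE zE) addrK.
  by apply: eq_bigr => r _; rewrite !mulr1.
have cPhi : cvgn Phi.
  apply: nonincreasing_is_cvgn; last first.
    by exists 0 => _ [n _ <-].
  apply/nonincreasing_seqP => n; rewrite -subr_ge0 PhiE sumr_ge0// => r rB.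
  by rewrite addr_ge0 ?elapsed_ge0 ?occupation_ge0 ?inZ.
under eq_fun do rewrite -PhiE.
rewrite -(subrr (limn Phi)).
apply: (@cvgB _ R^o); first exact: cPhi.
by rewrite (cvg_shiftS Phi).
Qed.

(** This holds for every solution (h, y), whatever its signs: the remainder is at most a constant
    times the sequence of [elapsed_occupation_cvg0]. *)
Lemma exit_series j h y : exit_system B p K j h y ->
  \sum_(0 <= n < N) elapsed n.+1 j @[N --> \oo] --> y i.
Proof.
move=> sys; have [BZ p0 _ _] := tp.
have inZ r : r \in B -> r \in Z by move/(fintype.subsetP BZ).
have hE r : r \in B -> h r = p r j + \sum_(l in B) p r l * h l.
  by move=> /sys[-> _]; rewrite addrC.
have yE r : r \in B -> y r = K r j + \sum_(l in B) K r l * h l +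
    \sum_(l in B) p r l * y l.
  by move=> /sys[_ ->]; rewrite (addrC (K r j)).
(* Telescoping: the pairing at time 0 is y i, and step N removes exactly [elapsed N.+1 j]. *)
have sumE N : \sum_(0 <= n < N) elapsed n.+1 j = y i - pairing N h y.
  elim: N => [|N ih].
    rewrite big_nil /pairing (bigD1 i)//= eqxx mul0r mul1r add0r big1 ?addr0 ?subrr//.
    by move=> r /andP[_ /negbTE ->]; rewrite !mul0r addr0.
  rewrite big_nat_recr//= ih.
  rewrite (@pairing_step N (p ^~ j) (K ^~ j) h y hE yE).
  by ring.
rewrite (funext sumE) -[y i in X in _ --> X]subr0; apply: (@cvgB _ R^o); first exact: cvg_cst.
pose C := \sum_(r in B) (`|h r| + `|y r|).
have C0 : 0 <= C by rewrite sumr_ge0// => r _; rewrite addr_ge0.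
apply/norm_cvg0P.
apply: (@squeeze_cvgr _ _ _ _ (fun=> 0)
  (fun n => (\sum_(r in B) (elapsed n r + occupation n r)) * C)).
- apply: nearW => n /=; rewrite normr_ge0/=.
  apply: le_trans (ler_norm_sum _ _ _) _.
  rewrite mulr_suml; apply: ler_sum => r rB.
  have e0 := elapsed_ge0 n r (inZ _ rB).
  have o0 := occupation_ge0 n r (inZ _ rB).
  apply: le_trans (ler_normD _ _) _; rewrite !normrM (ger0_norm e0) (ger0_norm o0) mulrDl.
  have hC : `|h r| + `|y r| <= C.
    by rewrite /C (bigD1 r)//= lerDl sumr_ge0// => l _; rewrite addr_ge0.
  have := normr_ge0 (h r); have := normr_ge0 (y r).
  by move=> *; apply: lerD; apply: ler_wpM2l => //; lra.
- exact: cvg_cst.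
- rewrite -[X in _ --> X](mul0r C); apply: cvgMr_tmp.
  exact: elapsed_occupation_cvg0.
Qed.

End ExitSeries.

(** * From the Markov property to the exit series *)

Section HittingTime.
Context {R : realType} {M : nat}.
Variables (X : markov_renewal R M) (D : {set 'I_M}).
Implicit Types (i j l r : 'I_M) (n m : nat) (A : set (mr_space X)).

Local Notation T := (mr_space X).
Local Notation P := (mr_prob X).
Local Notation eta := (@mr_eta R M X).
Local Notation kappa := (@mr_kappa R M X).

(** The mean of kappa_1 on the event eta_1 = j. It is 0 when p_ij = 0, and [fine] is faithful at the
    finite means granted by [mean_fin]. *)
Definition mr_mean i j : R := mr_p X i j * fine (mr_e X i j).

Lemma mr_p_ge0 i j : 0 <= mr_p X i j. Proof. exact: fine_ge0. Qed.

Lemma mr_mean_ge0 i j : 0 <= mr_mean i j.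
Proof.
rewrite mulr_ge0 ?mr_p_ge0// fine_ge0//; apply: integral_ge0 => t /=.
by rewrite in_itv/= andbT lee_fin.
Qed.

Lemma mr_pE i j : P i (eta 1 @^-1` [set j]) = (mr_p X i j)%:E.
Proof. by rewrite /mr_p fineK// fin_num_measure//; exact: mr_eta_measurable. Qed.

Lemma mr_QE i j t :
  P i [set w | eta 1 w = j /\ kappa 1 w <= t] = (mr_Q X i j t)%:E.
Proof. by rewrite /mr_Q fineK// fin_num_measure//; exact: mr_Q_measurable. Qed.

Lemma trivIset_eta n : trivIset setT (fun l => eta n @^-1` [set l]).
Proof. by move=> l l' _ _ [w [/= <- <-]]. Qed.

Lemma mr_sum_p i : \sum_j mr_p X i j = 1.
Proof.
apply: EFin_inj; rewrite -sumEFin -(probability_setT (P i)).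
under eq_bigr do rewrite -mr_pE.
rewrite -measure_bigsetU_ord//; last 2 first.
- by move=> l; exact: mr_eta_measurable.
- exact: trivIset_eta.
congr (P i _); rewrite -bigcup_pred; apply/seteqP; split => // w _.
by exists (eta 1 w).
Qed.

Lemma history_measurable n A : history eta kappa n A -> measurable A.
Proof.
move: A; apply: smallest_sub; first exact: sigma_algebra_measurable.
move=> A [m _ [[l ->]|[Y mY ->]]]; first exact: mr_eta_measurable.
by rewrite -[X in measurable X]setTI; exact: mr_kappa_measurable.
Qed.

(** The Markov property is given on the events kappa <= t; letting t run through the integers
    exhausts them. *)
Lemma mr_markov_p i n A l j : history eta kappa n A ->
  (P i (A `&` eta n @^-1` [set l] `&` eta n.+1 @^-1` [set j]) =
   P i (A `&` eta n @^-1` [set l]) * (mr_p X l j)%:E)%E.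
Proof.
move=> hA; have mA := history_measurable _ _ hA.
have mAl : measurable (A `&` eta n @^-1` [set l]).
  by apply: measurableI => //; exact: mr_eta_measurable.
pose C k m := [set w | eta k w = j /\ kappa k w <= m%:R].
have mC k m : measurable (C k m).
  rewrite (_ : C _ _ = eta k @^-1` [set j] `&`
      (setT `&` kappa k @^-1` `]-oo, m%:R])); last first.
    by apply/seteqP; split=> w /=; rewrite in_itv/=; [move=> [? ?] | move=> [? [_ ?]]].
  apply: measurableI; first exact: mr_eta_measurable.
  by apply: mr_kappa_measurable.
have UC k : \bigcup_m C k m = eta k @^-1` [set j].
  apply/seteqP; split => [w [m _ []]//|w /= wj].
  exists (Num.truncn (kappa k w)).+1 => //; split => //.
  by rewrite ltW// truncnS_gt.
have ndC k : nondecreasing_seq (C k).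
  move=> m m' mm'; apply/subsetPset => w [? wm]; split => //.
  by apply: le_trans wm _; rewrite ler_nat.
have H1 : P i (A `&` eta n @^-1` [set l] `&` C n.+1 m) @[m --> \oo] -->
    P i (A `&` eta n @^-1` [set l] `&` eta n.+1 @^-1` [set j]).
  rewrite -UC setI_bigcupr; apply: nondecreasing_cvg_mu.
  - by move=> m; exact: measurableI.
  - by apply: bigcup_measurable => m _; exact: measurableI.
  - move=> m m' mm'; apply/subsetPset; apply: setIS.
    exact/subsetPset/ndC.
have H2 : (P i (A `&` eta n @^-1` [set l]) * P l (C 1%N m))%E @[m --> \oo] -->
    (P i (A `&` eta n @^-1` [set l]) * (mr_p X l j)%:E)%E.
  apply: cvgeZl; first exact: fin_num_measure.
  rewrite -mr_pE -UC; apply: nondecreasing_cvg_mu => //.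
  exact: bigcup_measurable.
apply: cvg_unique H1 _; first exact: ereal_hausdorff.
move: H2; apply: cvg_trans; apply: near_eq_cvg; apply: nearW => m.
by rewrite -mr_markov.
Qed.

(** For the newest holding time: A is an event where a history of probability c ends at r and the
    next jump goes to l, so that on A the law of kappa_n is c p_rl times F_rl. If p_rl = 0, then A
    is null and both sides vanish. *)
Lemma integral_kappa_law i l r A n (c : R) : measurable A -> 0 <= c ->
  (0 < mr_p X r l -> (mr_e X r l < +oo)%E) ->
  P i A = (c * mr_p X r l)%:E ->
  (forall t, P i (A `&` [set w | kappa n w <= t]) = (c * mr_Q X r l t)%:E) ->
  (\int[P i]_(w in A) (kappa n w)%:E = (c * mr_mean r l)%:E)%E.
Proof.
move=> mA c0 efin PA law.
have [p0|p0] := eqVneq (mr_p X r l) 0.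
  rewrite /mr_mean p0 mul0r mulr0; apply: null_set_integral => //.
    apply: measurable_funTS; apply/measurable_EFinP.
    exact: mr_kappa_measurable.
  by move: PA; rewrite p0 mulr0.
have pgt0 : 0 < mr_p X r l by rewrite lt_def p0 mr_p_ge0.
have c0' : 0 <= c * mr_p X r l by rewrite mulr_ge0 ?mr_p_ge0.
have meanE : (\int[lebesgue_stieltjes_measure (mr_Fij X r l)]_(t in `[0%R, +oo[) t%:E)%E
    = (fine (mr_e X r l))%:E.
  rewrite fineK// ge0_fin_numE ?efin//; apply: integral_ge0 => t /=.
  by rewrite in_itv/= andbT lee_fin.
rewrite (ge0_integral_law _ _ _ (P i) A mA (kappa n) (c * mr_p X r l)
  (lebesgue_stieltjes_measure (mr_Fij X r l))) => //.
- by rewrite meanE -EFinM mulrA.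
- exact: mr_kappa_measurable.
- exact: mr_kappa_ge0.
move=> Y mY.
rewrite -(lebesgue_stieltjes_scaled_df _ (NngNum c0') (mr_Fij X r l))//.
pose k' : T -> measurableTypeR R := kappa n.
have mk' : measurable_fun setT k' by exact: mr_kappa_measurable.
pose mk : {mfun T >-> measurableTypeR R} := HB.pack k' (isMeasurableFun.Build _ _ _ _ k' mk').
rewrite (@lebesgue_stieltjes_of_halfline _ _ (pushforward (mrestr (P i) mA) mk))//.
  by rewrite /pushforward/= /mrestr setIC.
move=> t; rewrite /= /pushforward /mrestr setIC.
have -> : k' @^-1` `]-oo, t] = [set w | kappa n w <= t].
  by apply/seteqP; split => w /=; rewrite in_itv.
rewrite law /scaled_df/= /mr_Fij; congr (_%:E).
by rewrite -mulrA; congr (_ * _); rewrite mulrC divfK.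
Qed.

(** For m <= n the event that kappa_m lies in Y belongs to the history up to n, so the jump to j
    multiplies the whole law of kappa_m by p_lj. *)
Lemma integral_kappa_past i n m A l j : history eta kappa n A -> (m <= n)%N ->
  (\int[P i]_(w in A `&` eta n @^-1` [set l] `&` eta n.+1 @^-1` [set j]) (kappa m w)%:E =
   (mr_p X l j)%:E * \int[P i]_(w in A `&` eta n @^-1` [set l]) (kappa m w)%:E)%E.
Proof.
move=> hA mn; have mA := history_measurable _ _ hA.
have mAl : measurable (A `&` eta n @^-1` [set l]).
  by apply: measurableI => //; exact: mr_eta_measurable.
have mAlj : measurable (A `&` eta n @^-1` [set l] `&` eta n.+1 @^-1` [set j]).
  by apply: measurableI => //; exact: mr_eta_measurable.
pose k' : T -> measurableTypeR R := kappa m.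
have mk' : measurable_fun setT k' by exact: mr_kappa_measurable.
pose mk : {mfun T >-> measurableTypeR R} := HB.pack k' (isMeasurableFun.Build _ _ _ _ k' mk').
pose nu := pushforward (mrestr (P i) mAl) mk.
have E1 : (\int[P i]_(w in A `&` eta n @^-1` [set l]) (kappa m w)%:E =
    1%:E * \int[nu]_(t in `[0%R, +oo[) t%:E)%E.
  apply: ge0_integral_law => //.
  - exact: mr_kappa_ge0.
  - by move=> Y mY; rewrite mul1e /nu /= /pushforward /mrestr setIC.
rewrite E1 mul1e; apply: ge0_integral_law => //.
- exact: mr_kappa_ge0.
- exact: mr_p_ge0.
move=> Y mY; rewrite /nu /= /pushforward /mrestr.
rewrite (_ : _ `&` kappa m @^-1` Y =
  (A `&` kappa m @^-1` Y) `&` eta n @^-1` [set l] `&` eta n.+1 @^-1` [set j]); last first.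
  by apply/seteqP; split => w [[]] => [[]|[]] //.
rewrite mr_markov_p; last first.
  pose G := [set A | exists2 m, (m <= n)%N &
         (exists l, A = eta m @^-1` [set l]) \/
         (exists2 B, measurable B & A = kappa m @^-1` B)].
  apply: (@measurableI _ (g_sigma_algebraType G)); first exact: hA.
  by apply: sub_sigma_algebra; exists m => //; right; exists Y.
rewrite muleC; congr (_ * P i _)%E.
by apply/seteqP; split => w /=; [move=> [[? ?] ?]|move=> [? [? ?]]].
Qed.


(** Time 0 is excluded as in [mr_nu]. Time n is excluded too, so that [first_visit n l] means
    survival when l is outside D and exit at time n when l is in D. *)
Definition avoids n : set T := [set w | forall m, (0 < m < n)%N -> eta m w \notin D].

Definition first_visit n l : set T := avoids n `&` eta n @^-1` [set l].

Local Notation total n := (fun w => \sum_(1 <= m < n.+1) kappa m w).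

Lemma avoidsS n : (0 < n)%N -> avoids n.+1 =
  avoids n `&` \big[setU/set0]_(l in (~: D)%SET) eta n @^-1` [set l].
Proof.
move=> n0; rewrite -bigcup_pred; apply/seteqP; split => w /=.
  move=> H; split=> [m /andP[m0 mn]|]; first by apply: H; rewrite m0 ltnW.
  exists (eta n w) => //=.
  by rewrite finset.in_setC H// n0/=.
move=> [H [l /= lD] nl] m /andP[m0]; rewrite ltnS leq_eqVlt => /orP[/eqP ->|mn].
  by rewrite nl -finset.in_setC.
by apply: H; rewrite m0.
Qed.

Lemma history_eta n m l : (m <= n)%N -> history eta kappa n (eta m @^-1` [set l]).
Proof. by move=> mn; apply: sub_sigma_algebra; exists m => //; left; exists l. Qed.

Lemma history_avoids n k : (n <= k.+1)%N -> history eta kappa k (avoids n).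
Proof.
pose G := [set A | exists2 m, (m <= k)%N &
  (exists l, A = eta m @^-1` [set l]) \/
  (exists2 B, measurable B & A = kappa m @^-1` B)].
elim: n => [_|[|n] ih nk].
- rewrite (_ : avoids 0 = setT); last by apply/seteqP; split => // w _ m; rewrite ltn0 andbF.
  exact: (@measurableT _ (g_sigma_algebraType G)).
- rewrite (_ : avoids 1 = setT); last by apply/seteqP; split => // w _ [].
  exact: (@measurableT _ (g_sigma_algebraType G)).
rewrite avoidsS//; apply: (@measurableI _ (g_sigma_algebraType G)).
  by apply: ih; exact: ltnW.
apply: (@bigsetU_measurable _ (g_sigma_algebraType G)) => l _.
exact: history_eta.
Qed.

Lemma measurable_first_visit n l : measurable (first_visit n l).
Proof.
apply: measurableI; last exact: mr_eta_measurable.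
by apply: (history_measurable n); apply: history_avoids; exact: leqnSn.
Qed.

Lemma first_visitS n l : (0 < n)%N -> first_visit n.+1 l =
  \big[setU/set0]_(r in (~: D)%SET)
    (avoids n `&` eta n @^-1` [set r] `&` eta n.+1 @^-1` [set l]).
Proof.
move=> n0; rewrite /first_visit avoidsS// -!bigcup_pred.
by rewrite setI_bigcupr setI_bigcupl.
Qed.

Lemma trivIset_first_visit n l : trivIset setT
  (fun r => avoids n `&` eta n @^-1` [set r] `&` eta n.+1 @^-1` [set l]).
Proof. by move=> r r' _ _ [w [[[_ /= <-] _] [[_ /= <-] _]]]. Qed.

Lemma first_visit_prob i n l : i \notin D ->
  P i (first_visit n.+1 l) = (occupation (~: D)%SET (mr_p X) i n.+1 l)%:E.
Proof.
move=> iD; elim: n l => [|n ih] l.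
  rewrite /= (bigD1 i) ?finset.in_setC//= eqxx mul1r big1 ?addr0; last first.
    by move=> r /andP[_ /negbTE ->]; rewrite mul0r.
  rewrite -mr_pE; congr (P i _).
  by apply/seteqP; split => w; [case|split => // -[]].
rewrite first_visitS// measure_bigsetU_ord; last 2 first.
- move=> r; apply: measurableI; last exact: mr_eta_measurable.
  exact: measurable_first_visit.
- exact: trivIset_first_visit.
rewrite [RHS]/= -sumEFin; apply: eq_bigr => r rD.
rewrite [LHS]mr_markov_p; last exact: history_avoids.
by rewrite [P i _]ih.
Qed.

Hypothesis mean_fin :
  forall r l, r \notin D -> 0 < mr_p X r l -> (mr_e X r l < +oo)%E.

Lemma measurable_total n (A : set T) : measurable_fun A (total n).
Proof.
apply: measurable_funTS; apply: measurable_sum => m.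
exact: mr_kappa_measurable.
Qed.

Lemma total_ge0 n w : 0 <= total n w.
Proof. by rewrite sumr_ge0// => m _; exact: mr_kappa_ge0. Qed.

Lemma integral_total i n A : measurable A ->
  (\int[P i]_(w in A) (total n w)%:E =
   \sum_(1 <= m < n.+1) \int[P i]_(w in A) (kappa m w)%:E)%E.
Proof.
move=> mA; rewrite -ge0_integral_sum//.
- by apply: eq_integral => w _; rewrite sumEFin.
- move=> m; apply: measurable_funTS; apply/measurable_EFinP.
  exact: mr_kappa_measurable.
- by move=> m w _; rewrite lee_fin mr_kappa_ge0.
Qed.

Lemma first_visit_time i n l : i \notin D ->
  (\int[P i]_(w in first_visit n.+1 l) (total n.+1 w)%:E =
   (elapsed (~: D)%SET (mr_p X) mr_mean i n.+1 l)%:E)%E.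
Proof.
move=> iD; elim: n l => [|n ih] l.
  rewrite /= (bigD1 i) ?finset.in_setC//= eqxx mul0r mul1r add0r big1 ?addr0; last first.
    by move=> r /andP[_ /negbTE ->]; rewrite !mul0r addr0.
  have -> : first_visit 1 l = eta 1 @^-1` [set l].
    by apply/seteqP; split => w; [case|split => // -[]].
  rewrite integral_total; last exact: mr_eta_measurable.
  rewrite big_nat1 (@integral_kappa_law i l i _ 1%N 1) ?mul1r//.
  - exact: mr_eta_measurable.
  - exact: mean_fin.
  - exact: mr_pE.
  - by move=> t; rewrite mul1r; exact: mr_QE.
have mF r : measurable (avoids n.+1 `&` eta n.+1 @^-1` [set r] `&` eta n.+2 @^-1` [set l]).
  apply: measurableI; last exact: mr_eta_measurable.
  exact: measurable_first_visit.
rewrite first_visitS// -big_enum ge0_integral_bigsetU//=; last 4 first.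
- exact: enum_uniq.
- by apply: sub_trivIset (trivIset_first_visit n.+1 l).
- by apply/measurable_EFinP; exact: measurable_total.
- by move=> w _; rewrite lee_fin total_ge0.
rewrite big_enum/= -sumEFin; apply: eq_bigr => r; rewrite finset.in_setC => rD.
(* The holding times before the last one are past and give [elapsed] times p_rl; the last one gives
   [occupation] times the mean. *)
rewrite integral_total// big_nat_recr//= EFinD; congr (_ + _)%E.
  rewrite mulrC EFinM -ih integral_total; last exact: measurable_first_visit.
  rewrite ge0_sume_distrr; last first.
    by move=> m _; apply: integral_ge0 => w _; rewrite lee_fin mr_kappa_ge0.
  apply: eq_big_nat => m /andP[_ mn].
  by apply: integral_kappa_past => //; exact: history_avoids.
have hA : history eta kappa n.+1 (avoids n.+1) by exact: history_avoids.
have PE := first_visit_prob i n r iD.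
apply: integral_kappa_law => //.
- by rewrite -lee_fin -PE.
- exact: mean_fin.
- by rewrite mr_markov_p// EFinM -PE.
- move=> t; rewrite EFinM -PE -mr_QE /first_visit -(mr_markov _ _ _ _ hA).
  by congr (P i _); apply/seteqP; split => w /=; [move=> [[? ?] ?]|move=> [? [? ?]]].
Qed.

Lemma mr_nuP w : if mr_nu D w is Some n
  then exists2 n', n = n'.+1 & first_visit n (eta n w) w /\ eta n w \in D
  else forall n, (0 < n)%N -> eta n w \notin D.
Proof.
rewrite /mr_nu; case: pselect => [h|h]; last first.
  by move=> n n0; apply/negP => nD; apply: h; exists n; rewrite n0.
case: ex_minnP => n /andP[n0 nD] nmin; exists n.-1; first by rewrite prednK.
split => //; split => // m /andP[m0 mn]; apply/negP => mD.
by have := nmin m; rewrite m0 mD => /(_ isT); rewrite leqNgt mn.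
Qed.

(** The integrand lives on the disjoint union over n of the events of exit at j at time n.+1;
    elsewhere it is 0, also on the paths that never meet D. *)
Lemma mr_E_series i j : i \notin D -> j \in D ->
  (mr_E X D i j =
   \sum_(0 <= n <oo) (elapsed (~: D)%SET (mr_p X) mr_mean i n.+1 j)%:E)%E.
Proof.
move=> iD jD; rewrite /mr_E; set f := fun w => EFin _.
pose U := \bigcup_n first_visit n.+1 j.
have fE n w : first_visit n.+1 j w -> f w = (total n.+1 w)%:E.
  move=> [wa /= wn]; rewrite /f; have := mr_nuP w; case: mr_nu => [m|]; last first.
    by move=> /(_ n.+1 isT); rewrite wn jD.
  move=> [m' -> [[wa' _] wD]].
  suff -> : m' = n by rewrite wn eqxx mulr1.
  case: (ltngtP m' n) => // mn.
    by have := wa m'.+1; rewrite /= ltnS mn wD => /(_ isT).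
  by have := wa' n.+1; rewrite /= ltnS mn wn jD => /(_ isT).
have f0 w : ~ U w -> f w = 0%E.
  move=> wU; rewrite /f; have := mr_nuP w; case: mr_nu => [m|//].
  move=> [m' -> [wf wD]]; case: eqP => [wj|]; last by rewrite mulr0.
  by exfalso; apply: wU; exists m' => //; rewrite -wj.
have mfv n : measurable (first_visit n.+1 j) by exact: measurable_first_visit.
transitivity (\int[P i]_(w in U) f w)%E.
  rewrite [RHS]integral_mkcond; apply: eq_integral => w _.
  by rewrite patchE; case: ifPn => // /negP wU; apply: f0 => /mem_set.
rewrite ge0_integral_bigcup//.
- apply: eq_eseriesr => n _.
  rewrite -first_visit_time//; apply: eq_integral => w /set_mem.
  exact: fE.
- apply/measurable_fun_bigcup => // n.
  apply: (@eq_measurable_fun _ _ _ _ _ (fun w => (total n.+1 w)%:E)).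
    by move=> w /set_mem /fE ->.
  by apply/measurable_EFinP; exact: measurable_total.
- by move=> w [n _ /fE ->]; rewrite lee_fin total_ge0.
- move=> n m _ _ [w [[wa /= wn] [wa' /= wm]]].
  case: (ltngtP m n) => // mn.
    by have := wa m.+1; rewrite /= ltnS mn wm jD => /(_ isT).
  by have := wa' n.+1; rewrite /= ltnS mn wn jD => /(_ isT).
Qed.

Lemma mr_E_exit_system i j h y : transient (~: D)%SET finset.setT (mr_p X) ->
  i \notin D -> j \in D -> exit_system (~: D)%SET (mr_p X) mr_mean j h y ->
  mr_E X D i j = (y i)%:E.
Proof.
move=> tp iD jD sys; rewrite mr_E_series//; apply: cvg_lim => //.
have iB : i \in (~: D)%SET by rewrite finset.in_setC.
have H := @exit_series _ _ _ _ _ _ _ tp iB (fun r l _ _ => mr_mean_ge0 r l) _ _ _ sys.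
under eq_fun do rewrite sumEFin.
by apply: cvg_EFin; [exact: nearW | exact: H].
Qed.

End HittingTime.

(** * Integration against a measure with a density *)

Section Density.
Context d (T : measurableType d) (R : realType).
Variables (mu nu : {measure set T -> \bar R}) (g : T -> R).
Hypotheses (mg : measurable_fun setT g) (g0 : forall x, 0 <= g x).
Hypothesis nuE : forall A, measurable A -> nu A = (\int[mu]_(x in A) (g x)%:E)%E.

Import HBNNSimple.

Lemma ge0_integral_density (f : T -> \bar R) :
  measurable_fun setT f -> (forall x, 0 <= f x)%E ->
  (\int[nu]_x f x = \int[mu]_x (f x * (g x)%:E))%E.
Proof.
move=> mf f0; have mEg : measurable_fun setT (fun x => (g x)%:E) by exact/measurable_EFinP.
pose f_ := nnsfun_approx measurableT mf.
have mf_ n : measurable_fun setT (fun x => (f_ n x)%:E).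
  exact/measurable_EFinP/measurable_funP.
have simple (h : {nnsfun T >-> R}) :
    (\int[nu]_x (h x)%:E = \int[mu]_x ((h x)%:E * (g x)%:E))%E.
  have indicg r : measurable_fun setT (fun x => (\1_(h @^-1` [set r]) x)%:E * (g x)%:E)%E.
    by apply: emeasurable_funM => //; exact/measurable_EFinP.
  under [RHS]eq_integral => x _.
    rewrite fimfunE -fsumEFin// ge0_mule_fsuml; last first.
      by move=> r; rewrite EFinM nnfun_muleindic_ge0.
    under eq_fsbigr do rewrite EFinM -muleA.
    over.
  rewrite ge0_integral_fsum//=; last 2 first.
  - by move=> r; apply: measurable_funeM.
  - by move=> r x _; rewrite muleA mule_ge0 ?nnfun_muleindic_ge0 ?lee_fin.
  rewrite integralT_nnsfun sintegralE; apply: eq_fsbigr => r.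
  rewrite inE => -[x _ hxr].
  rewrite ge0_integralZl//=; last 2 first.
  - by move=> t _; rewrite mule_ge0// lee_fin.
  - by rewrite lee_fin -hxr.
  congr (_ * _)%E; rewrite nuE// [LHS]integral_mkcond; apply: eq_integral => t _.
  by rewrite patchE indicE; case: ifPn => _; rewrite ?mul1e ?mul0e.
transitivity (limn (fun n => \int[nu]_x (f_ n x)%:E))%E.
  rewrite -monotone_convergence//.
  - by apply: eq_integral => x _; apply/esym/cvg_lim => //; exact: cvg_nnsfun_approx.
  - by move=> n x _; rewrite lee_fin.
  - by move=> x _ m n mn; rewrite lee_fin; exact/lefP/nd_nnsfun_approx.
under eq_fun do rewrite simple.
rewrite -monotone_convergence//.
- apply: eq_integral => x _; apply/cvg_lim => //.
  by apply: cvgeZr; [|exact: cvg_nnsfun_approx].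
- by move=> n; exact: emeasurable_funM.
- by move=> n x _; rewrite mule_ge0// lee_fin.
- move=> x _ m n mn; rewrite -!EFinM lee_fin ler_wpM2r//.
  exact/lefP/nd_nnsfun_approx.
Qed.

End Density.

(** * Laplace transforms and their means *)

Section Laplace.
Context {R : realType}.
Implicit Types (phi psi : R -> R) (s t : R).

Local Notation pos t := (Num.max 0 t).

(* The maximum makes the transform that of a measure on [0, oo[, without any
   condition on the support of mu. *)
Definition is_laplace phi : Prop :=
  exists mu : {measure set (measurableTypeR R) -> \bar R}, forall s, 0 <= s ->
    (\int[mu]_t (expR (- s * pos t))%:E = (phi s)%:E)%E.

Lemma measurable_laplace_kernel d (T : measurableType d) (Y : T -> R) (s : R) (A : set T) :
  measurable_fun setT Y -> measurable_fun A (fun x => (expR (- s * Y x))%:E).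
Proof.
move=> mY; apply: measurable_funTS; apply/measurable_EFinP.
apply: measurableT_comp => //.
by apply: measurable_funM.
Qed.

Lemma measurable_pos d (T : measurableType d) (Y : T -> R) :
  measurable_fun setT Y -> measurable_fun setT (fun x => pos (Y x)).
Proof. by move=> mY; exact: measurable_maxr. Qed.

Lemma measurable_pos_id : measurable_fun [set: measurableTypeR R] (fun t : R => pos t).
Proof. by apply: (@measurable_pos _ (measurableTypeR R) id); exact: measurable_id. Qed.

Lemma is_laplace_rv d (T : measurableType d) (mu : {measure set T -> \bar R})
    (Y : T -> R) phi : measurable_fun setT Y -> (forall x, 0 <= Y x) ->
  (forall s, 0 <= s -> (\int[mu]_x (expR (- s * Y x))%:E = (phi s)%:E)%E) ->
  is_laplace phi.
Proof.
move=> mY Y0 muE.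
pose Y' : T -> measurableTypeR R := Y.
pose mk : {mfun T >-> measurableTypeR R} := HB.pack Y' (isMeasurableFun.Build _ _ _ _ Y' mY).
exists (pushforward mu mk) => s s0.
rewrite (@ge0_integral_pushforward _ _ _ (measurableTypeR R) _ Y' mY)//=.
- rewrite preimage_setT -muE//; apply: eq_integral => x _ /=.
  by rewrite max_r.
- apply: (@measurable_laplace_kernel _ (measurableTypeR R)).
  exact: measurable_pos_id.
Unshelve. exact: mY. Qed.

Lemma is_laplace_prob phi : is_laplace phi -> phi 0 = 1 ->
  exists P : probability (measurableTypeR R) R, forall s, 0 <= s ->
    (\int[P]_t (expR (- s * pos t))%:E = (phi s)%:E)%E.
Proof.
move=> [mu muE] phi0.
have mu1 : mu setT = 1%E.
  have := muE 0 (lexx _); rewrite phi0.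
  under eq_integral do rewrite oppr0 mul0r expR0.
  by rewrite integral_cst// mul1e.
(* The mass of mu is phi 0 = 1, so normalising changes nothing; the Dirac mass is only the fallback
   argument. *)
exists (mnormalize mu (@dirac _ (measurableTypeR R) 0 R)) => s s0.
rewrite -muE//; apply: eq_measure_integral => A mA _ /=.
by rewrite /mnormalize mu1 /= onee_eq0 /= invr1 mule1.
Qed.

Lemma is_laplace_bounds phi s : is_laplace phi -> phi 0 = 1 -> 0 <= s ->
  0 <= phi s <= 1.
Proof.
move=> lphi phi0 s0; have [P PE] := is_laplace_prob _ lphi phi0.
rewrite -!lee_fin -PE//; apply/andP; split.
  by apply: integral_ge0 => t _; rewrite lee_fin expR_ge0.
rewrite -(probability_setT P) -[leRHS]mul1e -integral_cst//.
apply: ge0_le_integral => //.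
- apply: (@measurable_laplace_kernel _ (measurableTypeR R)).
  exact: measurable_pos_id.
- by move=> t _; rewrite lee_fin /= -expR0 ler_expR mulNr oppr_le0 mulr_ge0// le_max lexx.
Qed.

Lemma is_laplace_scale phi (w : R) : 0 <= w -> is_laplace phi ->
  is_laplace (fun s => phi (w * s)).
Proof.
move=> w0 [mu muE].
apply: (@is_laplace_rv _ (measurableTypeR R) mu (fun t => w * pos t)).
- by apply: measurable_funM => //; exact: measurable_pos_id.
- by move=> t; rewrite mulr_ge0// le_max lexx.
- move=> s s0; rewrite -muE ?mulr_ge0//; apply: eq_integral => t _.
  by rewrite -mulNr mulrA [- s * w]mulrC mulrN mulNr.
Qed.

Lemma is_laplace_mix phi psi (q : R) : 0 <= q <= 1 -> is_laplace phi -> is_laplace psi ->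
  is_laplace (fun s => q * phi s + (1 - q) * psi s).
Proof.
move=> /andP[q0 q1] [mu muE] [nu nuE].
have q1' : 0 <= 1 - q by rewrite subr_ge0.
exists (measure_add (mscale (NngNum q0) mu) (mscale (NngNum q1') nu)) => s s0.
have mk := @measurable_laplace_kernel _ (measurableTypeR R) _ s setT measurable_pos_id.
have k0 t : (0 <= (expR (- s * pos t))%:E)%E by rewrite lee_fin expR_ge0.
rewrite ge0_integral_measure_add// !ge0_integral_mscale//=.
by rewrite muE// nuE// -!EFinM -EFinD.
Qed.

Lemma is_laplace_series (phi_ : nat -> R -> R) (a : nat -> R) phi :
  (forall n, is_laplace (phi_ n)) -> (forall n, 0 <= a n) ->
  (forall s, 0 <= s -> \sum_(0 <= k < n) a k * phi_ k s @[n --> \oo] --> phi s) ->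
  is_laplace phi.
Proof.
move=> /choice[mu muE] a0 aphi.
exists (mseries (fun n => mscale (NngNum (a0 n)) (mu n)) 0) => s s0.
have mk := @measurable_laplace_kernel _ (measurableTypeR R) _ s setT measurable_pos_id.
have k0 t : (0 <= (expR (- s * pos t))%:E)%E by rewrite lee_fin expR_ge0.
rewrite ge0_integral_measure_series//.
under eq_eseriesr do rewrite ge0_integral_mscale// muE// -EFinM.
apply: cvg_lim => //.
under eq_fun do rewrite sumEFin.
by apply: cvg_EFin; [exact: nearW | exact: aphi].
Qed.

(** The sum of two independent variables, realised on the product space. *)
Lemma is_laplace_mul phi psi : is_laplace phi -> phi 0 = 1 ->
  is_laplace psi -> psi 0 = 1 -> is_laplace (fun s => phi s * psi s).
Proof.
move=> /is_laplace_prob H1 /H1 [P PE] /is_laplace_prob H2 /H2 [Q QE].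
pose Y (z : measurableTypeR R * measurableTypeR R) : R := pos z.1 + pos z.2.
have mY : measurable_fun setT Y.
  apply: measurable_funD.
    by apply: (measurableT_comp measurable_pos_id).
  by apply: (measurableT_comp measurable_pos_id).
apply: (@is_laplace_rv _ _ (P \x Q)%E Y) => //.
  by move=> z; rewrite addr_ge0// le_max lexx.
move=> s s0.
have mk2 := @measurable_laplace_kernel _ _ _ s setT mY.
rewrite fubini_tonelli1//=.
have mk := @measurable_laplace_kernel _ (measurableTypeR R) _ s setT measurable_pos_id.
have k0 t : (0 <= (expR (- s * pos t))%:E)%E by rewrite lee_fin expR_ge0.
rewrite /fubini_F /Y/=.
under eq_integral => x _.
  under eq_integral => y _ do rewrite mulrDr expRD EFinM.
  rewrite ge0_integralZl// QE// muleC.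
  over.
have q0 : (0 <= (psi s)%:E)%E by rewrite -QE//; apply: integral_ge0.
by rewrite ge0_integralZl//= PE// -EFinM mulrC.
Qed.

Lemma is_laplace1 : is_laplace (fun=> 1).
Proof.
apply: (@is_laplace_rv _ R (@dirac _ R 0 R) (fun=> 0)) => // s _.
by rewrite integral_dirac//= diracT mul1e mulr0 expR0.
Qed.

Lemma is_laplace_exp phi n : is_laplace phi -> phi 0 = 1 ->
  is_laplace (fun s => phi s ^+ n).
Proof.
move=> lphi phi0; elim: n => [|n ih]; first exact: is_laplace1.
under eq_fun do rewrite exprS.
by apply: is_laplace_mul => //; rewrite phi0 expr1n.
Qed.

(** One variable of transform phi plus a geometric number of independent ones of transform psi: the
    quotient is expanded in powers of p psi. *)
Lemma is_laplace_geometric phi psi (p : R) : is_laplace phi -> phi 0 = 1 ->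
  is_laplace psi -> psi 0 = 1 -> 0 <= p < 1 ->
  is_laplace (fun s => (1 - p) * phi s / (1 - p * psi s)).
Proof.
move=> lphi phi0 lpsi psi0 /andP[p0 p1].
apply: (@is_laplace_series (fun n s => phi s * psi s ^+ n) (fun n => (1 - p) * p ^+ n)).
- move=> n; apply: is_laplace_mul => //; last by rewrite psi0 expr1n.
  exact: is_laplace_exp.
- by move=> n; rewrite mulr_ge0 ?exprn_ge0// subr_ge0 ltW.
- move=> s s0; have /andP[psi_ge0 psi_le1] := is_laplace_bounds _ s lpsi psi0 s0.
  have : `|p * psi s| < 1.
    rewrite ger0_norm ?mulr_ge0//; apply: le_lt_trans p1.
    by rewrite ler_piMr.
  move=> /(@cvg_geometric_series R ((1 - p) * phi s) _).
  apply: cvg_trans; apply: near_eq_cvg; apply: nearW => n.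
  rewrite /series/=; apply: eq_bigr => k _.
  by rewrite exprMn; ring.
Qed.

Lemma is_laplace_exponential (e : R) : 0 <= e -> is_laplace (fun s => (1 + e * s)^-1).
Proof.
rewrite le_eqVlt => /predU1P[<-|e0].
  by under eq_fun do rewrite mul0r addr0 invr1; exact: is_laplace1.
have r0 : 0 < e^-1 by rewrite invr_gt0.
have [nu nuE] : exists nu : {measure set (measurableTypeR R) -> \bar R},
    forall A, nu A = exponential_prob e^-1 A.
  by unshelve eexists (exponential_prob e^-1).
apply: (@is_laplace_rv _ (measurableTypeR R) nu (fun t => pos t)).
- exact: measurable_pos_id.
- by move=> t; rewrite le_max lexx.
- move=> s s0.
  have mpdf (r : R) : measurable_fun setT (fun x => (exponential_pdf r x)%:E).
    by apply/measurable_EFinP; exact: measurable_exponential_pdf.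
  have pdf0 (r : R) x : 0 < r -> (0 <= (exponential_pdf r x)%:E)%E.
    by move=> r_gt0; rewrite lee_fin exponential_pdf_ge0// ltW.
  rewrite (@ge0_integral_density _ (measurableTypeR R) R lebesgue_measure nu
    (exponential_pdf e^-1) (measurable_exponential_pdf _)
    (exponential_pdf_ge0 (ltW r0)) (fun A _ => nuE A)); last 2 first.
  - apply: (@measurable_laplace_kernel _ (measurableTypeR R)).
    exact: measurable_pos_id.
  - by move=> x; rewrite lee_fin expR_ge0.
  have es0 : 0 < e^-1 + s by rewrite ltr_wpDr.
  (* Tilting: the density of rate 1/e times exp(- s x) is (1 + e s)^-1 times the density of rate 1/e
     + s. *)
  transitivity (\int[lebesgue_measure]_x
      (((1 + e * s)^-1)%:E * (exponential_pdf (e^-1 + s) x)%:E))%E.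
    apply: eq_integral => x _; rewrite -!EFinM; congr EFin.
    have [x0|x0] := leP 0 x; last by rewrite !lt0_exponential_pdf// !mulr0.
    rewrite !exponential_pdfE//.
    rewrite mulrCA -expRD mulrA; congr (_ * expR _); last by ring.
    have : e != 0 by rewrite gt_eqF.
    have : 1 + e * s != 0 by rewrite gt_eqF// ltr_wpDr// mulr_ge0// ltW.
    by move=> *; field; apply/andP.
  rewrite ge0_integralZl//; last 3 first.
  - exact: mpdf.
  - by move=> x _; exact: pdf0.
  - by rewrite lee_fin invr_ge0 addr_ge0// mulr_ge0// ltW.
  by rewrite integral_exponential_pdf// mule1.
Qed.

(** Both bounds come from 1 + x <= exp x, taken at x = s y and at x = - s y. *)
Lemma expRN_quotient_bounds (s y : R) : 0 < s -> 0 <= y ->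
  y / (1 + s * y) <= (1 - expR (- s * y)) / s <= y.
Proof.
move=> s0 y0.
have sy0 : 0 <= s * y by rewrite mulr_ge0// ltW.
have d0 : 0 < 1 + s * y by rewrite ltr_wpDr.
rewrite ler_pdivlMr// ler_pdivrMr//; apply/andP; split; last first.
  by have := expR_ge1Dx (- s * y); lra.
have : expR (- s * y) <= (1 + s * y)^-1.
  by rewrite mulNr expRN lef_pV2 ?posrE ?expR_gt0// expR_ge1Dx.
suff -> : y / (1 + s * y) * s = 1 - (1 + s * y)^-1 by lra.
by field; rewrite gt_eqF.
Qed.

(* Fatou's lemma and the bound of the integrands by Y suffice, so the limit may
   be infinite. *)
Lemma integral_quotient_cvg d (T : measurableType d) (mu : {measure set T -> \bar R})
    (A : set T) (Y : T -> R) (u : nat -> R) :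
  measurable A -> measurable_fun A Y -> (forall x, A x -> 0 <= Y x) ->
  (forall n, 0 < u n) -> u n @[n --> \oo] --> 0 ->
  (\int[mu]_(x in A) ((1 - expR (- u n * Y x)) / u n)%:E)%E @[n --> \oo] -->
  (\int[mu]_(x in A) (Y x)%:E)%E.
Proof.
move=> mA mY Y0 u0 ucvg.
pose f n x := ((1 - expR (- u n * Y x)) / u n)%:E.
have mf n : measurable_fun A (f n).
  apply/measurable_EFinP; apply: measurable_funM => //.
  apply: measurable_funB => //; apply: measurableT_comp => //.
  by apply: measurable_funM.
have bnd n x : A x -> Y x / (1 + u n * Y x) <= (1 - expR (- u n * Y x)) / u n <= Y x.
  by move=> Ax; apply: expRN_quotient_bounds => //; exact: Y0.
have f0 n x : A x -> (0 <= f n x)%E.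
  move=> Ax; have /andP[+ _] := bnd n x Ax; rewrite lee_fin; apply: le_trans.
  by rewrite divr_ge0 ?Y0// addr_ge0// mulr_ge0 ?Y0// ltW.
have fcvg x : A x -> f n x @[n --> \oo] --> (Y x)%:E.
  move=> Ax; apply: cvg_EFin; first exact: nearW.
  apply: (@squeeze_cvgr _ _ _ _ (fun n => Y x / (1 + u n * Y x)) (fun=> Y x)).
  - by apply: nearW => n; exact: bnd.
  - rewrite -[Y x in X in _ --> X]mulr1 -[1 in X in _ --> X]invr1.
    apply: cvgMl_tmp; apply: cvgV; first exact: oner_neq0.
    rewrite -[1 in X in _ --> X]addr0 -[0 in X in _ --> X](mul0r (Y x)).
    by apply: (@cvgD _ R^o); [exact: cvg_cst|exact: cvgMr_tmp].
  - exact: cvg_cst.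
have up n : (\int[mu]_(x in A) f n x <= \int[mu]_(x in A) (Y x)%:E)%E.
  apply: ge0_le_integral => //.
  - by move=> x Ax; exact: f0.
  - exact/measurable_EFinP.
  - by move=> x Ax; rewrite lee_fin; have /andP[] := bnd n x Ax.
have low : (\int[mu]_(x in A) (Y x)%:E <= limn_einf (fun n => \int[mu]_(x in A) f n x))%E.
  apply: le_trans (fatou mu mA mf f0).
  rewrite le_eqVlt; apply/orP; left; apply/eqP; apply: eq_integral => x /set_mem Ax.
  by have [-> _] := cvg_limn_einf_sup (fcvg x Ax).
apply/cvgeNP; apply: (limn_esup_le_cvg (u := fun n => - \int[mu]_(x in A) f n x)%E).
  by have := limn_esupN (fun n => \int[mu]_(x in A) f n x)%E; rewrite /comp => ->; rewrite leeN2.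
by move=> n; rewrite leeN2.
Qed.

Lemma integral_quotient d (T : measurableType d) (mu : {measure set T -> \bar R})
    (A : set T) (Y : T -> R) (s a b : R) :
  measurable A -> measurable_fun A Y -> (forall x, A x -> 0 <= Y x) -> 0 < s ->
  mu A = a%:E -> (\int[mu]_(x in A) (expR (- s * Y x))%:E = b%:E)%E ->
  (\int[mu]_(x in A) ((1 - expR (- s * Y x)) / s)%:E = ((a - b) / s)%:E)%E.
Proof.
move=> mA mY Y0 s0 muA intb.
have me : measurable_fun A (fun x => expR (- s * Y x)).
  by apply: measurableT_comp => //; exact: measurable_funM.
have e1 x : A x -> 0 <= 1 - expR (- s * Y x).
  move=> Ax; rewrite subr_ge0 -expR0 ler_expR mulNr oppr_le0 mulr_ge0 ?Y0//.
  exact: ltW.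
have m1e : measurable_fun A (fun x => (1 - expR (- s * Y x))%:E).
  by apply/measurable_EFinP; exact: measurable_funB.
under eq_integral do rewrite mulrC EFinM.
rewrite ge0_integralZl//; last by rewrite lee_fin invr_ge0 ltW.
have : (\int[mu]_(x in A) (1 - expR (- s * Y x))%:E + b%:E = a%:E)%E.
  rewrite -intb -ge0_integralD//; last exact/measurable_EFinP.
  under eq_integral do rewrite -EFinD subrK.
  by rewrite integral_cst// mul1e.
move=> /(congr1 (fun z => z - b%:E)%E); rewrite addeK// => ->.
by rewrite -EFinB -EFinM mulrC.
Qed.

(* m is the right derivative of - phi at 0, that is, the mean of the
   distribution of transform phi. *)
Definition laplace_mean phi (m : R) : Prop :=
  [/\ is_laplace phi, phi 0 = 1 & (1 - phi s) / s @[s --> 0^'+] --> m].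

Lemma laplace_mean_continuous phi m : laplace_mean phi m -> phi s @[s --> 0^'+] --> (1 : R).
Proof.
move=> [_ _ dphi].
have : 1 - (1 - phi s) / s * s @[s --> 0^'+] --> 1 - m * 0.
  apply: (@cvgB _ R^o); first exact: cvg_cst.
  by apply: cvgM => //; exact/cvg_at_right_filter/cvg_id.
rewrite mulr0 subr0; apply: cvg_trans; apply: near_eq_cvg.
by near=> s; rewrite divfK ?subKr// gt_eqF.
Unshelve. all: by end_near. Qed.

Lemma cvg_at_right0_scale (f : R -> R) (w l : R) : 0 < w ->
  f s @[s --> 0^'+] --> l -> f (w * s) @[s --> 0^'+] --> l.
Proof.
move=> w0 /cvg_at_rightP fl; apply/cvg_at_rightP => u [u0 ucvg].
apply: (fl (fun n => w * u n)); split; first by move=> n; rewrite mulr_gt0.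
by rewrite -(mulr0 w); exact: cvgMl_tmp.
Qed.

(** The factor w may be 0, as a limiting ratio of normalisations can be; the transform is then the
    constant 1, with mean 0. *)
Lemma laplace_mean_scale phi m (w : R) : 0 <= w -> laplace_mean phi m ->
  laplace_mean (fun s => phi (w * s)) (w * m).
Proof.
move=> w0 lm; have [lphi phi0 dphi] := lm.
split; [exact: is_laplace_scale | by rewrite mulr0 |].
move: w0; rewrite le_eqVlt => /predU1P[<-|w0].
  rewrite mul0r; under eq_fun do rewrite mul0r phi0 subrr mul0r.
  exact: cvg_cst.
have : w * ((1 - phi (w * s)) / (w * s)) @[s --> 0^'+] --> w * m.
  by apply: cvgMl_tmp; exact: (cvg_at_right0_scale (fun s => (1 - phi s) / s)).
apply: cvg_trans; apply: near_eq_cvg; near=> s.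
have s0 : s != 0 by rewrite gt_eqF.
by field; rewrite s0 gt_eqF.
Unshelve. all: by end_near. Qed.

Lemma laplace_mean_mix phi psi m l (q : R) : 0 <= q <= 1 ->
  laplace_mean phi m -> laplace_mean psi l ->
  laplace_mean (fun s => q * phi s + (1 - q) * psi s) (q * m + (1 - q) * l).
Proof.
move=> q01 [lphi phi0 dphi] [lpsi psi0 dpsi].
split; [exact: is_laplace_mix | by rewrite phi0 psi0; ring |].
have : q * ((1 - phi s) / s) + (1 - q) * ((1 - psi s) / s) @[s --> 0^'+] -->
    q * m + (1 - q) * l.
  by apply: (@cvgD _ R^o); exact: cvgMl_tmp.
apply: cvg_trans; apply: near_eq_cvg; near=> s; rewrite /=.
by ring.
Unshelve. all: by end_near. Qed.

Lemma laplace_mean_mul phi psi m l : laplace_mean phi m -> laplace_mean psi l ->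
  laplace_mean (fun s => phi s * psi s) (m + l).
Proof.
move=> pm pl; have cphi := laplace_mean_continuous _ _ pm.
have [lphi phi0 dphi] := pm; have [lpsi psi0 dpsi] := pl.
split; [exact: is_laplace_mul | by rewrite phi0 psi0 mulr1 |].
(* Product rule: 1 - phi psi = (1 - phi) + phi (1 - psi), where phi tends to 1. *)
have : (1 - phi s) / s + phi s * ((1 - psi s) / s) @[s --> 0^'+] --> m + 1 * l.
  by apply: (@cvgD _ R^o) => //; exact: cvgM.
rewrite mul1r; apply: cvg_trans; apply: near_eq_cvg; near=> s; rewrite /=.
by ring.
Unshelve. all: by end_near. Qed.

Lemma laplace_mean_geometric phi psi m l (p : R) : 0 <= p < 1 ->
  laplace_mean phi m -> laplace_mean psi l ->
  laplace_mean
    (fun s => (1 - p) * phi ((1 - p) * s) / (1 - p * psi ((1 - p) * s)))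
    ((1 - p) * m + p * l).
Proof.
move=> /andP[p0 p1] pm pl.
have q0 : 0 < 1 - p by rewrite subr_gt0.
have qm := laplace_mean_scale _ _ _ (ltW q0) pm.
have ql := laplace_mean_scale _ _ _ (ltW q0) pl.
have cpsi := laplace_mean_continuous _ _ ql.
have [lphi phi0 dphi] := qm; have [lpsi psi0 dpsi] := ql.
have dn0 s : 0 <= s -> 1 - p * psi ((1 - p) * s) != 0.
  move=> s0; have /andP[psi1 psi2] := is_laplace_bounds _ s lpsi psi0 s0.
  by rewrite gt_eqF// subr_gt0; apply: le_lt_trans p1; rewrite ler_piMr.
split.
- apply: (is_laplace_geometric (fun s => phi ((1 - p) * s)) (fun s => psi ((1 - p) * s))) => //.
  by rewrite p0.
- by rewrite phi0 psi0 !mulr1 divff// gt_eqF.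
have c1 : (1 - p * psi ((1 - p) * s))^-1 @[s --> 0^'+] --> (1 - p * 1)^-1.
  apply: cvgV; first by rewrite mulr1 gt_eqF.
  by apply: (@cvgB _ R^o); [exact: cvg_cst|exact: cvgMl_tmp].
(* The numerator rests on 1 - p psi - (1 - p) phi = p (1 - psi) + (1 - p) (1 - phi). The denominator
   tends to 1 - p, which the scaling of time by 1 - p cancels. *)
have : (p * ((1 - psi ((1 - p) * s)) / s) + (1 - p) * ((1 - phi ((1 - p) * s)) / s)) *
    (1 - p * psi ((1 - p) * s))^-1 @[s --> 0^'+] -->
    (p * ((1 - p) * l) + (1 - p) * ((1 - p) * m)) * (1 - p * 1)^-1.
  by apply: cvgM => //; apply: (@cvgD _ R^o); exact: cvgMl_tmp.
rewrite mulr1 [X in _ --> X -> _](_ : _ = (1 - p) * m + p * l); last first.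
  by field; rewrite gt_eqF.
apply: cvg_trans; apply: near_eq_cvg; near=> s; rewrite /=.
have s0 : 0 < s by [].
by field; rewrite dn0 ?gt_eqF// ltW.
Unshelve. all: by end_near. Qed.

Lemma laplace_mean_exponential (e : R) : 0 <= e ->
  laplace_mean (fun s => (1 + e * s)^-1) e.
Proof.
move=> e0; split; [exact: is_laplace_exponential | by rewrite mulr0 addr0 invr1 |].
have : e / (1 + e * s) @[s --> 0^'+] --> e / (1 + e * 0).
  apply: cvgMl_tmp; apply: cvgV; first by rewrite mulr0 addr0 oner_neq0.
  apply: (@cvgD _ R^o); first exact: cvg_cst.
  by apply: cvgMl_tmp; exact/cvg_at_right_filter/cvg_id.
rewrite mulr0 addr0 invr1 mulr1; apply: cvg_trans; apply: near_eq_cvg; near=> s.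
have s0 : 0 < s by [].
have : 1 + e * s != 0 by rewrite gt_eqF// ltr_wpDr// mulr_ge0// ltW.
by move=> d0; field; rewrite d0 gt_eqF.
Unshelve. all: by end_near. Qed.

Lemma laplace_mean_df (F : cumulativeBounded (0 : R) (1 : R)) :
  (forall t, t < 0 -> F t = 0) -> (df_mean F < +oo)%E ->
  laplace_mean (fun s => fine (df_laplace F s)) (fine (df_mean F)).
Proof.
move=> F0 mF.
pose P : probability (measurableTypeR R) R := lebesgue_stieltjes_measure F.
pose A : set (measurableTypeR R) := `[0, +oo[%classic.
have mA : measurable A by exact: measurable_itv.
(* The open half-line is exhausted by closed ones with negative endpoints, where F vanishes. F may
   have an atom at 0, and this atom stays in A. *)
have PN : P `]-oo, 0[%classic = 0%E.
  apply/negligibleP; first exact: measurable_itv.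
  rewrite (_ : `]-oo, 0[%classic = \bigcup_n `]-oo, (- n.+1%:R^-1)%R]%classic); last first.
    apply/seteqP; split => [t /=|t [n _]]; rewrite /= !in_itv/=; last first.
      by move=> /le_lt_trans; apply; rewrite oppr_lt0 invr_gt0.
    move=> /ltr_add_invr[n tn]; exists n => //=.
    by rewrite in_itv/= -subr_le0 opprK ltW.
  apply: negligible_bigcup => n; apply/negligibleP; first exact: measurable_itv.
  by rewrite [LHS](cdf_lebesgue_stieltjes_id F (- n.+1%:R^-1)) F0// oppr_lt0 invr_gt0.
have PA : P A = 1%E.
  rewrite (_ : A = ~` `]-oo, 0[%classic); last by rewrite setCitvl.
  by rewrite probability_setC ?PN ?sube0//; exact: measurable_itv.
have A0 (t : measurableTypeR R) : A t -> 0 <= (t : R) by rewrite /A/= in_itv/= andbT.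
have mid : measurable_fun A (fun t : R => t) by exact: measurable_id.
have Lfin s : 0 <= s -> df_laplace F s \is a fin_num.
  move=> s0; rewrite ge0_fin_numE; last first.
    by apply: integral_ge0 => t _; rewrite lee_fin expR_ge0.
  apply: (@le_lt_trans _ _ (\int[P]_(t in A) cst 1 t)%E).
    apply: ge0_le_integral => //.
    - by apply: (@measurable_laplace_kernel _ (measurableTypeR R)); exact: measurable_id.
    - move=> t At; rewrite lee_fin -expR0 ler_expR mulNr oppr_le0 mulr_ge0//.
      exact: A0.
  by rewrite integral_cst// [X in (_ * X)%E]PA mule1 ltry.
have LE s : 0 <= s -> df_laplace F s = (fine (df_laplace F s))%:E.
  by move=> s0; rewrite fineK// Lfin.
split.
- apply: (@is_laplace_rv _ (measurableTypeR R) (mrestr P mA) (fun t => pos t)).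
  + exact: measurable_pos_id.
  + by move=> t; rewrite le_max lexx.
  + move=> s s0; rewrite ge0_integral_mrestr; last 2 first.
    * apply: (@measurable_laplace_kernel _ (measurableTypeR R)).
      exact: measurable_pos_id.
    * by move=> t; rewrite lee_fin expR_ge0.
    rewrite -LE//; apply: eq_integral => t /set_mem /A0 t0.
    by rewrite max_r.
- rewrite /df_laplace; under eq_integral do rewrite oppr0 mul0r expR0.
  by rewrite integral_cst// [X in (_ * X)%E]PA mule1.
apply/cvg_at_rightP => u [u0 ucvg].
have := @integral_quotient_cvg _ _ P A _ u mA mid A0 u0 ucvg.
under eq_fun => n.
  rewrite (@integral_quotient _ _ P A _ (u n) _ _ mA mid A0 (u0 n) PA (LE _ (ltW (u0 n)))).
  over.
rewrite -/(df_mean F) -[df_mean F]fineK; last first.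
  by rewrite ge0_fin_numE//; apply: integral_ge0 => t At; rewrite lee_fin A0.
by move/fine_cvg.
Qed.

(** The transform at 0 gives the mass c, and its difference quotients along u n = 1/(n+1) give the
    mean. Finiteness of the mean of G is part of the conclusion. *)
Lemma df_mean_laplace (G : cumulative R R) phi m (c : R) :
  laplace_mean phi m ->
  (forall s, 0 <= s -> df_laplace G s = (phi s * c)%:E) ->
  df_mean G = (m * c)%:E.
Proof.
move=> [_ phi0 dphi] GE.
pose P : {measure set (measurableTypeR R) -> \bar R} := lebesgue_stieltjes_measure G.
pose A : set (measurableTypeR R) := `[0, +oo[%classic.
have mA : measurable A by exact: measurable_itv.
have A0 (t : measurableTypeR R) : A t -> 0 <= (t : R) by rewrite /A/= in_itv/= andbT.
have mid : measurable_fun A (fun t : R => t) by exact: measurable_id.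
have PA : P A = c%:E.
  have := GE 0 (lexx _); rewrite phi0 mul1r => <-.
  rewrite /df_laplace; under eq_integral do rewrite oppr0 mul0r expR0.
  by rewrite integral_cst// mul1e.
pose u n : R := n.+1%:R^-1.
have u0 n : 0 < u n by rewrite invr_gt0.
have ucvg : u n @[n --> \oo] --> (0 : R) by exact: cvg_harmonic.
have := @integral_quotient_cvg _ _ P A _ u mA mid A0 u0 ucvg.
under eq_fun => n.
  rewrite (@integral_quotient _ _ P A _ (u n) _ _ mA mid A0 (u0 n) PA (GE _ (ltW (u0 n)))).
  over.
move=> H; apply: (cvg_unique _ H); first exact: ereal_hausdorff.
apply: cvg_EFin; first exact: nearW.
have : (1 - phi (u n)) / u n * c @[n --> \oo] --> m * c.
  by apply: cvgMr_tmp; move/cvg_at_rightP : dphi; exact.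
by apply: cvg_trans; apply: near_eq_cvg; apply: nearW => n /=; ring.
Qed.

Lemma laplace_df_exists phi (c : R) : is_laplace phi -> phi 0 = 1 -> 0 <= c <= 1 ->
  exists G : cumulative R R, possibly_improper_df G /\
    forall s, 0 <= s -> df_laplace G s = (phi s * c)%:E.
Proof.
move=> lphi phi0 /andP[c0 c1].
have [P PE] := is_laplace_prob _ lphi phi0.
(* [is_laplace] sees its measure only through the positive part; the push-forward is a law on [[0,
   +oo[], so its distribution function vanishes at negative t. *)
pose Y' : measurableTypeR R -> measurableTypeR R := fun t => pos t.
have mY' : measurable_fun setT Y' by exact: measurable_pos_id.
pose Y : {mfun measurableTypeR R >-> measurableTypeR R} :=
  HB.pack Y' (isMeasurableFun.Build _ _ _ _ Y' mY').
pose Q : probability (measurableTypeR R) R := distribution P Y.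
have [G [GE Gt]] := probability_df _ Q.
have QE (B : set R) : Q B = P (Y @^-1` B) by [].
exists (scaled_df _ (NngNum c0) G); split; first split.
- move=> t t0; change (c * G t = 0); rewrite Gt QE.
  rewrite (_ : Y @^-1` _ = set0) ?measure0 ?mulr0//.
  apply/seteqP; split => // x /=; rewrite in_itv/= => /(le_lt_trans) /(_ t0).
  by rewrite ltNge le_max lexx.
- move=> t; change (c * G t <= 1); rewrite Gt mulr_ile1 ?fine_ge0//.
  rewrite -lee_fin fineK; first by apply: probability_le1; exact: measurable_itv.
  by apply: fin_num_measure; exact: measurable_itv.
move=> s s0; rewrite /df_laplace.
have mk (A : set (measurableTypeR R)) : measurable_fun A (fun t : R => (expR (- s * t))%:E).
  by apply: (@measurable_laplace_kernel _ (measurableTypeR R)); exact: measurable_id.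
transitivity (\int[mscale (NngNum c0) Q]_(t in `[0%R, +oo[) (expR (- s * t))%:E)%E.
  apply: eq_measure_integral => B mB _.
  by rewrite [LHS](lebesgue_stieltjes_scaled_df _ (NngNum c0) G)// [X in (_ * X)%E]GE.
rewrite ge0_integral_mscale//=.
rewrite mulrC EFinM; congr (_ * _)%E; rewrite -PE//.
rewrite (@ge0_integral_pushforward _ _ _ (measurableTypeR R) _ Y)//=.
rewrite (_ : _ @^-1` _ = setT)//.
by apply/seteqP; split => // t _ /=; rewrite in_itv/= le_max lexx.
Qed.

End Laplace.

(** * Continuity points and supports of weak limits *)

Lemma cumulative_continuity_point (R : realType) (F : cumulative R R) (a b : R) :
  a < b -> exists2 c, a < c < b & {for c, continuous F}.
Proof.
move=> ab; have ndF := cumulative_is_nondecreasing F.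
have Zcount := @discontinuity_countable R a b F (in2W ndF).
have [c cab cd] : exists2 c, c \in `]a, b[ & ~ discontinuity F c.
  apply: contrapT => H.
  (* Otherwise the interval would consist of discontinuities only, hence be countable and of measure
     zero. *)
  have : lebesgue_measure (`]a, b[%classic : set R) = 0%E.
    rewrite -(countable_lebesgue_measure0 Zcount); congr lebesgue_measure.
    apply/seteqP; split => c /=; last by case.
    by move=> cab; split => //; apply: contrapT => cd; apply: H; exists c.
  rewrite lebesgue_measure_itv/= lte_fin ab -EFinB => -[] /eqP.
  by rewrite subr_eq0 gt_eqF.
exists c => //.
have cr : F x @[x --> c^'+] --> F c by exact: cumulative_is_right_continuous.
have cl : cvg (F x @[x --> c^'-]).
  apply: nondecreasing_at_left_is_cvgr.
    by apply: nearW => x y z _ _; exact: ndF.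
  near=> x; exists (F c) => _ [y /= + <-]; rewrite in_itv/= => /andP[_ yc].
  by apply: ndF; exact: ltW.
apply/left_right_continuousP; split => //.
suff <- : lim (F x @[x --> c^'-]) = F c by [].
(* [discontinuity] requires both one-sided limits to exist and to differ; they do exist, so its
   failure makes them equal. *)
apply: contrapT => /eqP lc; apply: cd; split => //.
  by apply/cvg_ex; exists (F c).
by rewrite (cvg_lim _ cr).
Unshelve. all: by end_near. Qed.

(** Weak convergence speaks only of continuity points, so G is shown to vanish at one between t and
    0. Monotonicity and the limit 0 at -oo then settle t. *)
Lemma weak_cvg_df_eq0 (R : realType) (F : R -> R -> R)
    (G : cumulativeBounded (0 : R) (1 : R)) :
  weak_cvg_df F G -> (forall t, t < 0 -> \forall e \near (0 : R)^'+, F e t = 0) ->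
  forall t, t < 0 -> G t = 0.
Proof.
move=> FG F0 t t0.
have ndG x y : x <= y -> G x <= G y by exact: cumulative_is_nondecreasing.
have [c /andP[tc c0] cc] := cumulative_continuity_point _ G _ _ t0.
have Gc : G c = 0.
  have /cvg_lim <- // := FG c cc.
  apply: lim_near_cst => //; exact: F0.
apply/le_anti/andP; split.
  by have := ndG _ _ (ltW tc); rewrite Gc.
suff : lim (G x @[x --> -oo]) <= G t.
  by rewrite (cvg_lim _ (cumulativeNy G)).
apply: limr_le; first by apply/cvg_ex; exists 0; exact: cumulativeNy.
near=> x; apply: ndG; near: x; exact: nbhs_ninfty_le.
Unshelve. all: by end_near. Qed.

Lemma mr_Fij_lt0 (R : realType) (M : nat) (X : markov_renewal R M) (i j : 'I_M) (t : R) :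
  t < 0 -> mr_Fij X i j t = 0.
Proof.
move=> t0; rewrite /mr_Fij /mr_Q (_ : [set _ | _] = set0) ?measure0 ?mul0r//.
apply/seteqP; split => // w [_] /le_lt_trans /(_ t0).
by rewrite ltNge mr_kappa_ge0.
Qed.

(** * Elimination along the enumeration of the states *)

Section LevelSets.
Context {R : realType} {M : nat}.
Variables (k : nat -> 'I_M) (D : {set 'I_M}).
Local Notation mb := #|(~: D)%SET|.

Lemma Xlev0 : Xlev k 0 = finset.setT.
Proof. by apply/finset.setP => i; rewrite !inE. Qed.

Lemma XlevS n : Xlev k n.+1 = (Xlev k n :\ k n.+1)%SET.
Proof.
have iotaS : iota 1 n.+1 = iota 1 n ++ [:: n.+1].
  by rewrite -[X in iota _ X]addn1 iotaD add1n.
by apply/finset.setP => i; rewrite finset.in_setD1 !finset.in_set iotaS map_cat mem_cat negb_or mem_seq1 andbC.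
Qed.

Lemma Dbarlev0 : Dbarlev k D 0 = (~: D)%SET.
Proof. by rewrite /Dbarlev Xlev0 finset.setTD. Qed.

Lemma DbarlevS n : Dbarlev k D n.+1 = (Dbarlev k D n :\ k n.+1)%SET.
Proof. by apply/finset.setP => i; rewrite /Dbarlev XlevS !inE andbCA. Qed.

Lemma Dbarlev_notin n i : i \in Dbarlev k D n -> i \notin D.
Proof. by rewrite inE => /andP[]. Qed.

Lemma Dbarlev_Xlev n i : i \in Dbarlev k D n -> i \in Xlev k n.
Proof. by rewrite inE => /andP[]. Qed.

Hypothesis Hk : enumeration_of k (~: D)%SET.

Lemma mem_enumeration i :
  (i \in [seq k n | n <- iota 1 mb]) = (i \notin D).
Proof. by rewrite (perm_mem Hk) mem_enum finset.in_setC. Qed.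

Lemma enumeration_inj : {in iota 1 mb &, injective k}.
Proof.
have : uniq (mkseq (fun l => k l.+1) mb).
  rewrite (_ : mkseq _ _ = [seq k n | n <- iota 1 mb]).
    by rewrite (perm_uniq Hk) enum_uniq.
  by rewrite (iotaDl 1 0) -map_comp.
move=> /mkseq_uniqP kinj [|l] [|l']; rewrite ?mem_iota// !add1n => lm lm' kl.
by congr S; apply: kinj.
Qed.

Lemma enumeration_Dbarlev n : (n < mb)%N -> k n.+1 \in Dbarlev k D n.
Proof.
move=> nm; have km : n.+1 \in iota 1 mb by rewrite mem_iota; exact: nm.
rewrite !inE -mem_enumeration map_f//=.
apply/negP => /mapP[l]; rewrite mem_iota add1n ltnS => /andP[l1 ln].
move=> /enumeration_inj E; have := ln; rewrite -E ?ltnn//.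
by rewrite mem_iota add1n ltnS l1 (leq_trans ln)// ltnW.
Qed.

Lemma exit_Xlev n j : (n <= mb)%N -> j \in D -> j \in Xlev k n.
Proof.
move=> nm jD; rewrite inE; apply/negP => /mapP[l].
rewrite mem_iota add1n ltnS => /andP[l1 ln] jl.
have : j \in [seq k n | n <- iota 1 mb].
  by rewrite jl map_f// mem_iota l1 add1n ltnS (leq_trans ln).
by rewrite mem_enumeration jD.
Qed.

Lemma Dbarlev_last : (0 < mb)%N -> Dbarlev k D mb.-1 = [set k mb]%SET.
Proof.
move=> m0; apply/finset.setP => i; rewrite [RHS]inE; apply/idP/eqP => [|->].
  rewrite !inE -mem_enumeration => /andP[/mapP[l lm ->] ] lm'; congr k.
  move: lm; rewrite mem_iota add1n ltnS => /andP[l1 lm].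
  apply/eqP; rewrite eqn_leq lm leqNgt/=; apply: contra lm' => lmb.
  by apply: map_f; rewrite mem_iota l1 add1n prednK.
by have := @enumeration_Dbarlev mb.-1; rewrite prednK//; apply.
Qed.

Variable p : 'I_M -> 'I_M -> R.
Hypothesis tp : transient (~: D)%SET finset.setT p.

Lemma transient_plev n : (n <= mb)%N ->
  transient (Dbarlev k D n) (Xlev k n) (plev k p n).
Proof.
elim: n => [_|n ih nm]; first by rewrite Dbarlev0 Xlev0.
rewrite DbarlevS XlevS.
apply: (@transient_eliminate _ _ _ _ (remove_loop (plev k p n))).
  exact/transient_remove_loop/ih/ltnW.
exact: enumeration_Dbarlev.
Qed.

Lemma plev_ge0 n i j : (n <= mb)%N -> i \in Dbarlev k D n -> j \in Xlev k n ->
  0 <= plev k p n i j.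
Proof. by move=> /transient_plev[_ + _ _]; apply. Qed.

Lemma plev_loop_lt1 n i : (n <= mb)%N -> i \in Dbarlev k D n -> plev k p n i i < 1.
Proof. by move=> nm; apply: transient_loop_lt1 (transient_plev _ nm). Qed.

Lemma ptilde_ge0 n i j : (n <= mb)%N -> i \in Dbarlev k D n -> j \in Xlev k n ->
  0 <= ptilde k p n i j.
Proof. by move=> /transient_plev/transient_remove_loop[_ + _ _]; apply. Qed.

Lemma ptilde_gt0 n i j : (n <= mb)%N -> i \in Dbarlev k D n ->
  (0 < ptilde k p n i j) = (j != i) && (0 < plev k p n i j).
Proof.
move=> nm iD; rewrite /ptilde; have [->|ji] := eqVneq j i.
  by rewrite remove_loop_diag ltxx.
by rewrite remove_loopE// pmulr_lgt0// invr_gt0 subr_gt0 plev_loop_lt1.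
Qed.

Lemma plevS_gt0 n i j : (n < mb)%N -> i \in Dbarlev k D n -> j \in Xlev k n ->
  (0 < plev k p n.+1 i j) = (0 < ptilde k p n i j) ||
    (0 < ptilde k p n i (k n.+1)) && (0 < ptilde k p n (k n.+1) j).
Proof.
move=> nm iD jX; have kD := enumeration_Dbarlev _ nm; have kX := Dbarlev_Xlev _ _ kD.
have nm' := ltnW nm.
have h1 := ptilde_ge0 _ _ _ nm' iD jX; have h2 := ptilde_ge0 _ _ _ nm' iD kX.
have h3 := ptilde_ge0 _ _ _ nm' kD jX.
rewrite [LHS]/= -/(ptilde k p n).
apply/idP/orP => [|[a|/andP[a b]]]; last 2 first.
- by rewrite ltr_pwDl// mulr_ge0.
- by rewrite ltr_wpDl// mulr_gt0.
move: h1; rewrite le_eqVlt => /predU1P[<-|->]; last by left.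
move: h2; rewrite le_eqVlt => /predU1P[<-|->]; first by rewrite mul0r add0r ltxx.
move: h3; rewrite le_eqVlt => /predU1P[<-|->]; first by rewrite mulr0 add0r ltxx.
by right.
Qed.

Variables (v : 'I_M -> R) (a : 'I_M -> 'I_M -> R).

Lemma vlev_gt0 n i : (forall i, i \notin D -> 1 <= v i) -> (n <= mb)%N ->
  i \in Dbarlev k D n -> 0 < vlev k p v n i.
Proof.
move=> v1; elim: n i => [i _ /Dbarlev_notin /v1|n ih i nm].
  by apply: lt_le_trans.
rewrite DbarlevS => /finset.setD1P[_ iD].
by rewrite /= divr_gt0 ?subr_gt0 ?plev_loop_lt1 ?ih// ltnW.
Qed.

Lemma vtilde_gt0 n i : (forall i, i \notin D -> 1 <= v i) -> (n <= mb)%N ->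
  i \in Dbarlev k D n -> 0 < vtilde k p v n i.
Proof.
by move=> v1 nm iD; rewrite divr_gt0 ?vlev_gt0// subr_gt0 plev_loop_lt1.
Qed.

(** The unnormalised matrices K^(n); the division by p^(n) v^(n) is postponed to the passage to the
    limit. *)
Fixpoint mean_lev n : 'I_M -> 'I_M -> R :=
  if n is m.+1 then
    eliminate_mean (k n) (ptilde k p m) (loop_mean (plev k p m) (mean_lev m))
  else a.

Definition mean_tilde n := loop_mean (plev k p n) (mean_lev n).

Lemma exit_system_lev n j h y : (n <= mb)%N -> j \in D ->
  exit_system (~: D)%SET p a j h y ->
  exit_system (Dbarlev k D n) (plev k p n) (mean_lev n) j h y.
Proof.
move=> nm jD sys; elim: n nm => [_|n ih nm]; first by rewrite Dbarlev0.
rewrite DbarlevS; apply: (@exit_system_eliminate _ _ _ (ptilde k p n)).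
- exact: enumeration_Dbarlev.
- exact: remove_loop_diag.
- by rewrite /loop_mean eqxx mul0r.
apply: exit_system_loop.
- by apply/negP => /Dbarlev_notin; rewrite jD.
- by move=> i; apply: plev_loop_lt1; exact: ltnW.
- exact/ih/ltnW.
Qed.

Lemma exit_system_last j h y : (0 < mb)%N -> j \in D ->
  exit_system (~: D)%SET p a j h y -> y (k mb) = mean_tilde mb.-1 (k mb) j.
Proof.
move=> m0 jD sys.
have nm : (mb.-1 <= mb)%N by exact: leq_pred.
have := exit_system_lev _ _ _ _ nm jD sys; rewrite (Dbarlev_last m0) => {}sys.
have kD : k mb \in Dbarlev k D mb.-1 by rewrite Dbarlev_last// finset.set11.
have jk : j \notin [set k mb]%SET.
  by rewrite inE; apply: contraTneq jD => ->; exact: Dbarlev_notin kD.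
have p1 i : i \in [set k mb]%SET -> plev k p mb.-1 i i < 1.
  by rewrite inE => /eqP ->; exact: plev_loop_lt1.
have [|_] := exit_system_loop _ _ _ _ _ _ jk p1 sys (k mb); first exact: finset.set11.
(* One state without a loop is left: both sums have a single, zero term. *)
rewrite !big_set1 remove_loop_diag {1}/loop_mean eqxx !mul0r add0r addr0.
by [].
Qed.

(** Means vanish wherever probabilities do. This removes the absent paths when the case distinctions
    of the recursion are matched at fixed eps. *)
Lemma mean_lev_eq0 n i j : (forall i j, i \notin D -> p i j = 0 -> a i j = 0) ->
  (n <= mb)%N -> i \in Dbarlev k D n -> j \in Xlev k n ->
  plev k p n i j = 0 -> mean_lev n i j = 0.
Proof.
move=> a0; elim: n i j => [|n ih] i j nm.
  by rewrite Dbarlev0 finset.in_setC => iD _; exact: a0.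
rewrite DbarlevS XlevS => /finset.setD1P[ik iD] /finset.setD1P[jk jX] pij.
have kD := enumeration_Dbarlev _ nm; have kX := Dbarlev_Xlev _ _ kD.
have t0 r l : r \in Dbarlev k D n -> l \in Xlev k n -> ptilde k p n r l = 0 ->
    mean_tilde n r l = 0.
  move=> rD lX prl; rewrite /mean_tilde /loop_mean.
  have [->|lr] := eqVneq l r; first by rewrite mul0r.
  have : plev k p n r l = 0.
    move: prl; rewrite /ptilde remove_loopE// => /eqP; rewrite mulf_eq0 => /orP[/eqP//|].
    by rewrite invr_eq0 subr_eq0 eq_sym lt_eqF// plev_loop_lt1// ltnW.
  by move=> p0; rewrite p0 (ih _ _ (ltnW nm) rD lX p0) !mul0r addr0 mulr0.
have : ~~ (0 < plev k p n.+1 i j) by rewrite pij ltxx.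
rewrite plevS_gt0// negb_or -!leNgt => /andP[pij0].
have z x : 0 <= x -> x <= 0 -> x = 0 :> R by move=> *; apply/le_anti/andP.
have pi0 := z _ (ptilde_ge0 _ _ _ (ltnW nm) iD jX) pij0.
rewrite /= /eliminate_mean -/(mean_tilde n) (t0 _ _ iD jX pi0) add0r.
rewrite negb_and -!leNgt => /orP[h|h].
  have pk0 := z _ (ptilde_ge0 _ _ _ (ltnW nm) iD kX) h.
  by rewrite pk0 (t0 _ _ iD kX pk0) !mul0r addr0.
have pk0 := z _ (ptilde_ge0 _ _ _ (ltnW nm) kD jX) h.
by rewrite pk0 (t0 _ _ kD jX pk0) !mulr0 addr0.
Qed.

End LevelSets.

Section Support.
Context {R : realType} {M : nat}.
Variables (k : nat -> 'I_M) (D : {set 'I_M}).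
Local Notation mb := #|(~: D)%SET|.
Hypothesis Hk : enumeration_of k (~: D)%SET.
Variables p q : 'I_M -> 'I_M -> R.
Hypothesis tp : transient (~: D)%SET finset.setT p.
Hypothesis tq : transient (~: D)%SET finset.setT q.
Hypothesis pq : forall i j, i \notin D -> (0 < p i j) = (0 < q i j).

(** The support at each level depends only on the support at level 0, so the sets defined at eps = 1
    serve for every eps. *)
Lemma plev_support n i j : (n <= mb)%N -> i \in Dbarlev k D n -> j \in Xlev k n ->
  (0 < plev k p n i j) = (0 < plev k q n i j).
Proof.
elim: n i j => [|n ih] i j nm; first by move=> /Dbarlev_notin iD _; exact: pq.
rewrite DbarlevS XlevS => /finset.setD1P[ik iD] /finset.setD1P[jk jX].
have kD := enumeration_Dbarlev _ _ Hk _ nm; have kX := Dbarlev_Xlev _ _ _ _ kD.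
have nm' := ltnW nm.
by rewrite !(plevS_gt0 _ _ Hk)// !(ptilde_gt0 _ _ Hk)// !ih.
Qed.

End Support.

Lemma near_unit_interval (R : realType) : \forall e \near (0 : R)^'+, 0 < e <= 1.
Proof.
near=> e; apply/andP; split=> //; near: e; apply: nbhs_right_le; exact: ltr01.
Unshelve. all: by end_near. Qed.

(** A chain from S into D leaves S; the edge at its first index outside S is the required escape,
    since the chain has stayed outside D until then. *)
Lemma transient_chain (R : realType) (M : nat) (D : {set 'I_M}) (p : 'I_M -> 'I_M -> R) :
  (forall i j, 0 <= p i j) -> (forall i, \sum_j p i j <= 1) ->
  (forall i, i \notin D -> exists (n : nat) (c : nat -> 'I_M),
     [/\ c 0%N = i, c n \in D &
         forall l, (l < n)%N -> c l \notin D -> 0 < p (c l) (c l.+1)]) ->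
  transient (~: D)%SET finset.setT p.
Proof.
move=> p0 p1 chain; split => //.
- by move=> i _; under eq_bigl do rewrite finset.in_setT.
move=> S SD /finset.set0Pn[i iS].
have inD l : l \in S -> l \notin D.
  by move=> /(fintype.subsetP SD); rewrite finset.in_setC.
have [n [c [c0 cn cp]]] := chain _ (inD _ iS).
have ex : exists l, c l \notin S.
  by exists n; apply: contraTN cn => /inD.
have : forall l, (l < ex_minn ex)%N -> c l \in S.
  move=> l; case: ex_minnP => m _ mmin; rewrite ltnNge; apply: contraR => lS.
  exact: mmin.
have : (ex_minn ex <= n)%N.
  by case: ex_minnP => m _; apply; apply: contraTN cn => /inD.
case: ex_minnP => -[|m] mS _ mn msub; first by rewrite c0 iS in mS.
have cmS : c m \in S by exact: msub.
by exists (c m), (c m.+1); split; rewrite ?finset.in_setT//; apply: cp => //; exact: inD.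
Qed.

Lemma laplace_mean_ge0 (R : realType) (phi : R -> R) (m : R) :
  laplace_mean phi m -> 0 <= m.
Proof.
move=> [lphi phi0 dphi]; rewrite -(cvg_lim _ dphi)//.
apply: limr_ge; first by apply/cvg_ex; exists m.
near=> s; have s0 : 0 < s by [].
have /andP[_ phi1] := is_laplace_bounds _ s lphi phi0 (ltW s0).
by rewrite divr_ge0 ?subr_ge0// ltW.
Unshelve. all: by end_near. Qed.

(** * Passage to the limit, level by level *)

Section Limits.
Set Implicit Arguments.
Context {R : realType} {M : nat}.
Variables (D : {set 'I_M}) (X : R -> markov_renewal R M) (v : R -> 'I_M -> R).
Variables (p0 : 'I_M -> 'I_M -> R).
Variable F0 : 'I_M -> 'I_M -> cumulativeBounded (0 : R) (1 : R).
Variables (k : nat -> 'I_M).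
Variables (pt0 qh0 : nat -> 'I_M -> 'I_M -> R) (w0 : nat -> 'I_M -> 'I_M -> \bar R).
Local Notation mb := #|(~: D)%SET|.
Local Notation p1 := (mr_p (X 1)).
Local Notation p eps := (mr_p (X eps)).

Hypothesis Hv : forall (eps : R) (i : 'I_M), 0 < eps <= 1 -> i \notin D -> 1 <= v eps i.
Hypothesis HB1 : forall i j : 'I_M, i \notin D ->
  (forall eps : R, 0 < eps <= 1 -> 0 < mr_p (X eps) i j) \/
  (forall eps : R, 0 < eps <= 1 -> mr_p (X eps) i j = 0).
Hypothesis HB2 : forall i : 'I_M, i \notin D ->
  exists (n : nat) (c : nat -> 'I_M),
    [/\ c 0%N = i,
        (forall l, (1 <= l < n)%N -> c l \notin D),
        c n \in D &
        0 < \prod_(1 <= l < n.+1) mr_p (X 1) (c l.-1) (c l)].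
Hypothesis HC : forall i j : 'I_M, i \notin D ->
  mr_p (X eps) i j @[eps --> 0^'+] --> p0 i j.
Hypothesis HDF : forall i j : 'I_M, i \notin D -> 0 < mr_p (X 1) i j ->
  weak_cvg_df (fun eps t => mr_Fij (X eps) i j (t * v eps i)) (F0 i j).
Hypothesis HE : forall i j : 'I_M, i \notin D -> 0 < mr_p (X 1) i j ->
  [/\ (forall eps : R, 0 < eps <= 1 -> (mr_e (X eps) i j < +oo)%E),
      (mr_e (X eps) i j * ((v eps i)^-1)%:E)%E @[eps --> 0^'+]
        --> df_mean (F0 i j) &
      (df_mean (F0 i j) < +oo)%E].
Hypothesis Hk : enumeration_of k (~: D)%SET.
Hypothesis Hi : forall (n : nat) (i j : 'I_M), (n < #|(~: D)%SET|)%N ->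
  i \in Dbarlev k D n -> j \in Xlev k n ->
  ptilde k (mr_p (X eps)) n i j @[eps --> 0^'+] --> pt0 n i j /\
  0 <= pt0 n i j <= 1.
Hypothesis Hii : forall (n : nat) (i j : 'I_M), (1 <= n < #|(~: D)%SET|)%N ->
  i \in Dbarlev k D n -> j \in Ylev k (mr_p (X 1)) n i ->
  qhat k (mr_p (X eps)) n i j @[eps --> 0^'+] --> qh0 n i j /\
  0 <= qh0 n i j <= 1.
Hypothesis Hiii : forall (n : nat) (i j : 'I_M), (1 <= n < #|(~: D)%SET|)%N ->
  i \in Dbarlev k D n.-1 -> j \in Dbarlev k D n.-1 ->
  (vtilde k (mr_p (X eps)) (v eps) n.-1 j /
   vtilde k (mr_p (X eps)) (v eps) n.-1 i)%:E @[eps --> 0^'+]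
    --> w0 n.-1 j i /\
  (0 <= w0 n.-1 j i)%E.
Hypothesis Hiv : forall (n : nat) (i : 'I_M), (1 <= n < #|(~: D)%SET|)%N ->
  i \in Dbarlev k D n.-1 -> (w0 n.-1 (k n) i < +oo)%E.

Lemma one_in_unit_interval : 0 < (1 : R) <= 1. Proof. by rewrite ltr01 lexx. Qed.

Lemma mr_p_support eps i j : 0 < eps <= 1 -> i \notin D -> (0 < p eps i j) = (0 < p1 i j).
Proof.
move=> e01 iD; case: (HB1 _ j iD) => H; first by rewrite !H ?one_in_unit_interval.
by rewrite !H ?one_in_unit_interval.
Qed.

Lemma transient_mr_p eps : 0 < eps <= 1 -> transient (~: D)%SET finset.setT (p eps).
Proof.
move=> e01; apply: transient_chain.
- by move=> i j; exact: mr_p_ge0.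
- by move=> i; rewrite mr_sum_p.
move=> i iD; have [n [c [c0 cD cn cp]]] := HB2 _ iD.
exists n, c; split => // l ln lD; rewrite mr_p_support// lt_def mr_p_ge0 andbT.
have : \prod_(1 <= l < n.+1) p1 (c l.-1) (c l) != 0 by rewrite gt_eqF.
rewrite prodf_seq_neq0 => /allP /(_ l.+1).
by rewrite mem_index_iota !ltnS ln => /(_ isT).
Qed.

Lemma plev_cvg n i j : (n < mb)%N -> i \in Dbarlev k D n -> j \in Xlev k n ->
  plev k (p eps) n i j @[eps --> 0^'+] --> p0lev k p0 pt0 n i j.
Proof.
case: n => [|n] nm; first by move=> /Dbarlev_notin iD _; exact: HC.
rewrite DbarlevS XlevS => /finset.setD1P[_ iD] /finset.setD1P[_ jX].
have nm' := ltnW nm; have kD := enumeration_Dbarlev _ _ Hk _ nm'.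
have kX := Dbarlev_Xlev _ _ _ _ kD.
apply: (@cvgD _ R^o); first by have [] := Hi nm' iD jX.
apply: cvgM; first by have [] := Hi nm' iD kX.
by have [] := Hi nm' kD jX.
Qed.

Lemma p0lev_bounds n i j : (n < mb)%N -> i \in Dbarlev k D n -> j \in Xlev k n ->
  0 <= p0lev k p0 pt0 n i j <= 1.
Proof.
move=> nm iD jX; have H := plev_cvg nm iD jX.
have cH : cvg (plev k (p eps) n i j @[eps --> 0^'+]).
  by apply/cvg_ex; eexists; exact: H.
rewrite -(cvg_lim _ H)//; apply/andP; split.
  apply: limr_ge => //; near=> eps.
  apply: (plev_ge0 _ _ Hk) (ltnW nm) iD jX; apply: transient_mr_p.
  by near: eps; exact: near_unit_interval.
apply: limr_le => //; near=> eps.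
apply: (transient_le1 _ _ _ _ _ _ iD jX).
apply: (transient_plev _ _ Hk _ _ _ (ltnW nm)); apply: transient_mr_p.
by near: eps; exact: near_unit_interval.
Unshelve. all: by end_near. Qed.

Lemma mem_Ylev n i j : (j \in Ylev k p1 n i) = (j \in Xlev k n) && (0 < plev k p1 n i j).
Proof. by rewrite finset.in_set. Qed.

Lemma mem_Ytilde n i j : (n <= mb)%N -> i \in Dbarlev k D n ->
  (j \in Ytilde k p1 n i) = (j \in Xlev k n) && (0 < ptilde k p1 n i j).
Proof.
move=> nm iD; rewrite finset.in_setD1 mem_Ylev.
by rewrite (ptilde_gt0 _ _ Hk _ (transient_mr_p _ one_in_unit_interval) _ _ _ nm iD) andbCA.
Qed.

Lemma laplace_mean_loop n i j : (n < mb)%N ->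
  (forall i j, i \in Dbarlev k D n -> j \in Ylev k p1 n i ->
     laplace_mean (phi0lev k p1 p0 pt0 qh0 w0 F0 n i j)
                  (e0lev k p1 p0 pt0 qh0 w0 F0 n i j)) ->
  i \in Dbarlev k D n -> j \in Ytilde k p1 n i ->
  laplace_mean (phitilde0 k p1 p0 pt0 qh0 w0 F0 n i j)
               (etilde0 k p1 p0 pt0 qh0 w0 F0 n i j).
Proof.
move=> nm lm iD /finset.setD1P[ji jY].
have iX := Dbarlev_Xlev _ _ _ _ iD.
have /andP[pge0 ple1] := p0lev_bounds nm iD iX.
rewrite /phitilde0 /etilde0 /loop_e /loop_phi.
have [iY|iY] := boolP (i \in Ylev k p1 n i); last exact: lm.
case: ltP => [plt1|pge1].
  by apply: laplace_mean_geometric; [rewrite pge0 | exact: lm | exact: lm].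
(* At p = 1 the loop law degenerates to the exponential one, and the formula for the mean reduces to
   e_ii. *)
have -> : p0lev k p0 pt0 n i i = 1 by apply/le_anti; rewrite ple1 pge1.
rewrite subrr mul0r add0r mul1r; apply: laplace_mean_exponential.
exact: laplace_mean_ge0 (lm _ _ iD iY).
Qed.

(** By (iv) the limit is finite, so [fine] in the recursions returns its true value. *)
Lemma cvg_vtilde_ratio n i : (n.+1 < mb)%N -> i \in Dbarlev k D n ->
  vtilde k (p eps) (v eps) n (k n.+1) / vtilde k (p eps) (v eps) n i
    @[eps --> 0^'+] --> fine (w0 n (k n.+1) i) /\ 0 <= fine (w0 n (k n.+1) i).
Proof.
move=> nm iD.
have kD := enumeration_Dbarlev _ _ Hk _ (ltnW nm).
have [wc wge0] := @Hiii n.+1 i (k n.+1) nm iD kD.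
have wlt := @Hiv n.+1 i nm iD.
split; last exact: fine_ge0.
have wfin : w0 n (k n.+1) i \is a fin_num by rewrite ge0_fin_numE.
by move: wc => /=; rewrite -(fineK wfin) => /fine_cvg.
Qed.

Lemma laplace_mean_lev n i j : (n < mb)%N -> i \in Dbarlev k D n -> j \in Ylev k p1 n i ->
  laplace_mean (phi0lev k p1 p0 pt0 qh0 w0 F0 n i j)
               (e0lev k p1 p0 pt0 qh0 w0 F0 n i j).
Proof.
elim: n i j => [|n ih] i j nm iD jY.
  have iD' := Dbarlev_notin _ _ _ _ iD.
  have pij : 0 < p1 i j by move: jY; rewrite mem_Ylev => /andP[].
  have [_ _ efin] := HE _ _ iD' pij.
  (* Holding times are nonnegative and v is positive, so the rescaled distribution functions vanish
     at negative t, and so does their weak limit. *)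
  apply: laplace_mean_df => // t; apply: (weak_cvg_df_eq0 _ _ _ (HDF _ _ iD' pij)).
  move=> {}t t0; near=> eps; apply: mr_Fij_lt0.
  rewrite pmulr_llt0//; apply: lt_le_trans (Hv _ _ _ iD') => //.
  by near: eps; exact: near_unit_interval.
have nm' := ltnW nm; have nm'' := ltnW nm'.
have kD := enumeration_Dbarlev _ _ Hk _ nm'; have kX := Dbarlev_Xlev _ _ _ _ kD.
have [_ /andP[q0 q1]] := @Hii n.+1 i j nm iD jY.
move: (iD); rewrite DbarlevS => /finset.setD1P[ik iDn].
have [_ w_ge0] := cvg_vtilde_ratio nm iDn.
have lm r l : r \in Dbarlev k D n -> l \in Ytilde k p1 n r ->
    laplace_mean (phitilde0 k p1 p0 pt0 qh0 w0 F0 n r l)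
                 (etilde0 k p1 p0 pt0 qh0 w0 F0 n r l).
  by apply: laplace_mean_loop => // r' l'; exact: ih.
rewrite /= /step_phi /step_e /= -/(etilde0 k p1 p0 pt0 qh0 w0 F0 n).
rewrite -/(phitilde0 k p1 p0 pt0 qh0 w0 F0 n).
have [jYi|jYi] := boolP (j \in Ytilde k p1 n i).
  case: ifPn => [/andP[kYi jYk]|_]; last exact: lm.
  apply: laplace_mean_mix; [by rewrite q0 | exact: lm |].
  by apply: laplace_mean_mul; [exact: lm | apply: laplace_mean_scale => //; exact: lm].
(* Case (c): p^(n+1)_ij is positive without a direct step from i to j, so the path through k is
   present. *)
have /andP[kYi jYk] : (k n.+1 \in Ytilde k p1 n i) && (j \in Ytilde k p1 n (k n.+1)).
  move: jY jYi; rewrite mem_Ylev XlevS finset.in_setD1 -andbA => /and3P[jk jX].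
  rewrite (plevS_gt0 _ _ Hk _ (transient_mr_p _ one_in_unit_interval))//.
  by rewrite !mem_Ytilde// jX kX/= => /orP[->|//].
by apply: laplace_mean_mul; [exact: lm | apply: laplace_mean_scale => //; exact: lm].
Unshelve. all: by end_near. Qed.

Local Notation mean_n eps := (mean_lev k (p eps) (mr_mean (X eps))).
Local Notation mean_t eps := (mean_tilde k (p eps) (mr_mean (X eps))).

Lemma mean_lev_support eps n i j : 0 < eps <= 1 -> (n <= mb)%N ->
  i \in Dbarlev k D n -> j \in Xlev k n -> plev k (p eps) n i j = 0 ->
  mean_n eps n i j = 0.
Proof.
move=> e01 nm iD jX; apply: (mean_lev_eq0 _ _ Hk _ (transient_mr_p _ e01)) => //.
by move=> r l _ prl; rewrite /mr_mean prl mul0r.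
Qed.

Lemma mean_tilde_support eps n i j : 0 < eps <= 1 -> (n <= mb)%N ->
  i \in Dbarlev k D n -> j \in Xlev k n -> ptilde k (p eps) n i j = 0 ->
  mean_t eps n i j = 0.
Proof.
move=> e01 nm iD jX pt.
have te := transient_mr_p _ e01.
rewrite /mean_tilde /loop_mean; have [->|ji] := eqVneq j i; first by rewrite mul0r.
have p0' : plev k (p eps) n i j = 0.
  apply/eqP; rewrite eq_le (plev_ge0 _ _ Hk _ te _ _ _ nm iD jX) andbT leNgt.
  apply/negP => pij.
  by have := ptilde_gt0 _ _ Hk _ te _ _ j nm iD; rewrite pt ltxx ji pij.
by rewrite p0' (mean_lev_support _ e01 nm iD jX p0') !mul0r addr0 mulr0.
Qed.

Lemma ptilde_neq0 eps n i j : 0 < eps <= 1 -> (n <= mb)%N ->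
  i \in Dbarlev k D n -> j \in Ytilde k p1 n i -> ptilde k (p eps) n i j != 0.
Proof.
move=> e01 nm iD; rewrite finset.in_setD1 mem_Ylev => /and3P[ji jX pij].
rewrite gt_eqF// (ptilde_gt0 _ _ Hk _ (transient_mr_p _ e01))// ji/=.
rewrite (plev_support _ _ Hk _ _ (transient_mr_p _ e01) (transient_mr_p _ one_in_unit_interval))//.
by move=> r l rD; exact: mr_p_support.
Qed.

Lemma ptilde_eq0 eps n i j : 0 < eps <= 1 -> (n <= mb)%N ->
  i \in Dbarlev k D n -> j \in Xlev k n -> j \notin Ytilde k p1 n i ->
  ptilde k (p eps) n i j = 0.
Proof.
move=> e01 nm iD jX; rewrite finset.in_setD1 mem_Ylev jX/= => h.
have te := transient_mr_p _ e01.
apply/eqP; rewrite eq_le (ptilde_ge0 _ _ Hk _ te _ _ _ nm iD jX) andbT leNgt.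
rewrite (ptilde_gt0 _ _ Hk _ te)//.
rewrite (plev_support _ _ Hk _ _ te (transient_mr_p _ one_in_unit_interval))//.
by move=> r l rD; exact: mr_p_support.
Qed.

Lemma mean_tilde_cvg n i j : (n < mb)%N ->
  (forall i j, i \in Dbarlev k D n -> j \in Ylev k p1 n i ->
     mean_n eps n i j / (plev k (p eps) n i j * vlev k (p eps) (v eps) n i)
       @[eps --> 0^'+] --> e0lev k p1 p0 pt0 qh0 w0 F0 n i j) ->
  i \in Dbarlev k D n -> j \in Ytilde k p1 n i ->
  mean_t eps n i j / (ptilde k (p eps) n i j * vtilde k (p eps) (v eps) n i)
    @[eps --> 0^'+] --> etilde0 k p1 p0 pt0 qh0 w0 F0 n i j.
Proof.
move=> nm ih iD jYt.
move: (jYt); rewrite finset.in_setD1 => /andP[ji jY].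
have jX : j \in Xlev k n by move: jY; rewrite mem_Ylev => /andP[].
have iX := Dbarlev_Xlev _ _ _ _ iD.
have nm' := ltnW nm.
have supp eps l : 0 < eps <= 1 -> l \in Xlev k n ->
    (0 < plev k (p eps) n i l) = (0 < plev k p1 n i l).
  move=> e01 lX.
  apply: (plev_support _ _ Hk _ _ (transient_mr_p _ e01) (transient_mr_p _ one_in_unit_interval)) => //.
  by move=> r s rD; exact: mr_p_support.
have facts eps : 0 < eps <= 1 -> [/\ 1 - plev k (p eps) n i i != 0,
    plev k (p eps) n i j != 0 & vlev k (p eps) (v eps) n i != 0].
  move=> e01; have te := transient_mr_p _ e01; split.
  - by rewrite subr_eq0 eq_sym lt_eqF// (plev_loop_lt1 _ _ Hk _ te).
  - by rewrite gt_eqF// supp//; move: jY; rewrite mem_Ylev => /andP[].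
  - rewrite gt_eqF// (vlev_gt0 _ _ Hk _ te)// => r rD; exact: Hv.
(* All powers of 1 - p_ii in denominators cancel, so the identity passes to the limit even if p_ii
   tends to 1. It is the recursion of [loop_e] with p_ii e_ii written as K_ii / v_i. *)
have tildeE eps : 0 < eps <= 1 ->
    mean_t eps n i j / (ptilde k (p eps) n i j * vtilde k (p eps) (v eps) n i) =
    (1 - plev k (p eps) n i i) *
      (mean_n eps n i j / (plev k (p eps) n i j * vlev k (p eps) (v eps) n i)) +
    mean_n eps n i i / vlev k (p eps) (v eps) n i.
  move=> /facts[d0 pij0 v_neq0].
  rewrite /mean_tilde /loop_mean /ptilde remove_loopE// ji mul1r /vtilde.
  by field; rewrite d0 pij0 v_neq0.
rewrite /etilde0 /loop_e.
have [iY|iY] := boolP (i \in Ylev k p1 n i) => /=.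
  have : (1 - plev k (p eps) n i i) *
      (mean_n eps n i j / (plev k (p eps) n i j * vlev k (p eps) (v eps) n i)) +
      plev k (p eps) n i i *
      (mean_n eps n i i / (plev k (p eps) n i i * vlev k (p eps) (v eps) n i))
      @[eps --> 0^'+] -->
      (1 - p0lev k p0 pt0 n i i) * e0lev k p1 p0 pt0 qh0 w0 F0 n i j +
      p0lev k p0 pt0 n i i * e0lev k p1 p0 pt0 qh0 w0 F0 n i i.
    apply: (@cvgD _ R^o); apply: cvgM; last 2 first.
    - exact: plev_cvg.
    - exact: ih.
    - by apply: (@cvgB _ R^o); [exact: cvg_cst | exact: plev_cvg].
    - exact: ih.
  apply: cvg_trans; apply: near_eq_cvg; near=> eps.
  have e01 : 0 < eps <= 1 by near: eps; exact: near_unit_interval.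
  rewrite tildeE//; congr (_ + _).
  have [d0 pij0 v_neq0] := facts _ e01.
  have : plev k (p eps) n i i != 0.
    by rewrite gt_eqF// supp//; move: iY; rewrite mem_Ylev => /andP[].
  by move=> pii0; field; rewrite pii0 v_neq0.
(* Without a loop at i, both p_ii and K_ii are 0 and the quotient does not change. *)
apply: cvg_trans (ih _ _ iD jY); apply: near_eq_cvg; near=> eps.
have e01 : 0 < eps <= 1 by near: eps; exact: near_unit_interval.
have pii0 : plev k (p eps) n i i = 0.
  apply/eqP; rewrite eq_le (plev_ge0 _ _ Hk _ (transient_mr_p _ e01) _ _ _ nm' iD iX).
  by rewrite andbT leNgt supp//; move: iY; rewrite mem_Ylev iX.
by rewrite tildeE// (mean_lev_support _ e01 nm' iD iX pii0) pii0 subr0 mul1r mul0r addr0.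
Unshelve. all: by end_near. Qed.

Lemma mean_lev_cvg n i j : (n < mb)%N -> i \in Dbarlev k D n -> j \in Ylev k p1 n i ->
  mean_n eps n i j / (plev k (p eps) n i j * vlev k (p eps) (v eps) n i)
    @[eps --> 0^'+] --> e0lev k p1 p0 pt0 qh0 w0 F0 n i j.
Proof.
elim: n i j => [|n ih] i j nm iD jY.
  have iD' := Dbarlev_notin _ _ _ _ iD.
  have pij : 0 < p1 i j by move: jY; rewrite mem_Ylev => /andP[].
  have [elt ecvg efin] := HE _ _ iD' pij.
  have mfin : df_mean (F0 i j) \is a fin_num.
    rewrite ge0_fin_numE//; apply: integral_ge0 => t /=.
    by rewrite in_itv/= andbT lee_fin.
  move: ecvg; rewrite -{1}(fineK mfin) => /fine_cvg.
  apply: cvg_trans; apply: near_eq_cvg; near=> eps.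
  have e01 : 0 < eps <= 1 by near: eps; exact: near_unit_interval.
  have efin' : mr_e (X eps) i j \is a fin_num.
    rewrite ge0_fin_numE ?elt//; apply: integral_ge0 => t /=.
    by rewrite in_itv/= andbT lee_fin.
  have v_gt0 : 0 < v eps i by apply: lt_le_trans (Hv _ _ e01 iD').
  rewrite /= fineM// /mr_mean/=.
  have : p eps i j != 0 by rewrite gt_eqF// mr_p_support.
  by move=> pn0; field; rewrite pn0 gt_eqF.
have nm' := ltnW nm; have nm'' := ltnW nm'.
have kD := enumeration_Dbarlev _ _ Hk _ nm'; have kX := Dbarlev_Xlev _ _ _ _ kD.
have [qc _] := @Hii n.+1 i j nm iD jY.
move: (iD); rewrite DbarlevS => /finset.setD1P[ik iDn].
have [wc _] := cvg_vtilde_ratio nm iDn.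
have jX : j \in Xlev k n.
  by move: jY; rewrite mem_Ylev XlevS finset.in_setD1 => /andP[/andP[]].
have lm r l : r \in Dbarlev k D n -> l \in Ytilde k p1 n r ->
    mean_t eps n r l / (ptilde k (p eps) n r l * vtilde k (p eps) (v eps) n r)
      @[eps --> 0^'+] --> etilde0 k p1 p0 pt0 qh0 w0 F0 n r l.
  by apply: mean_tilde_cvg => // r' l'; exact: ih.
have vt eps r : 0 < eps <= 1 -> r \in Dbarlev k D n -> vtilde k (p eps) (v eps) n r != 0.
  move=> e01 rD; rewrite gt_eqF// (vtilde_gt0 _ _ Hk _ (transient_mr_p _ e01))//.
  by move=> s sD; exact: Hv.
have levE eps : mean_n eps n.+1 i j /
    (plev k (p eps) n.+1 i j * vlev k (p eps) (v eps) n.+1 i) =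
    (mean_t eps n i j + mean_t eps n i (k n.+1) * ptilde k (p eps) n (k n.+1) j +
      ptilde k (p eps) n i (k n.+1) * mean_t eps n (k n.+1) j) /
    ((ptilde k (p eps) n i j +
      ptilde k (p eps) n i (k n.+1) * ptilde k (p eps) n (k n.+1) j) *
      vtilde k (p eps) (v eps) n i) by [].
have plevn0 eps : 0 < eps <= 1 -> ptilde k (p eps) n i j +
      ptilde k (p eps) n i (k n.+1) * ptilde k (p eps) n (k n.+1) j != 0.
  move=> e01.
  have : 0 < plev k (p eps) n.+1 i j.
    move: (jY); rewrite mem_Ylev => /andP[jX' pij'].
    rewrite (plev_support _ _ Hk _ _ (transient_mr_p _ e01) (transient_mr_p _ one_in_unit_interval))//.
    by move=> r l rD; exact: mr_p_support.
  by move=> H; rewrite gt_eqF.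
rewrite [e0lev _ _ _ _ _ _ _ _ _ _]/= /step_e /= -/(etilde0 k p1 p0 pt0 qh0 w0 F0 n).
have [jYi|jYi] := boolP (j \in Ytilde k p1 n i).
  case: ifPn => [/andP[kYi jYk]|Nkj].
    (* Case (a): [qhat] is the share of the direct step in p^(n+1)_ij and 1 - [qhat] that of the
       path through k. The ratio of the vtilde converts the normalisation of k to that of i. *)
    have : qhat k (p eps) n.+1 i j *
        (mean_t eps n i j / (ptilde k (p eps) n i j * vtilde k (p eps) (v eps) n i)) +
        (1 - qhat k (p eps) n.+1 i j) *
        (mean_t eps n i (k n.+1) /
           (ptilde k (p eps) n i (k n.+1) * vtilde k (p eps) (v eps) n i) +
         (vtilde k (p eps) (v eps) n (k n.+1) / vtilde k (p eps) (v eps) n i) *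
         (mean_t eps n (k n.+1) j /
           (ptilde k (p eps) n (k n.+1) j * vtilde k (p eps) (v eps) n (k n.+1))))
        @[eps --> 0^'+] -->
        qh0 n.+1 i j * etilde0 k p1 p0 pt0 qh0 w0 F0 n i j +
        (1 - qh0 n.+1 i j) * (etilde0 k p1 p0 pt0 qh0 w0 F0 n i (k n.+1) +
          fine (w0 n (k n.+1) i) * etilde0 k p1 p0 pt0 qh0 w0 F0 n (k n.+1) j).
      apply: (@cvgD _ R^o); first by apply: cvgM => //; exact: lm.
      apply: cvgM; first by apply: (@cvgB _ R^o) => //; exact: cvg_cst.
      apply: (@cvgD _ R^o); first exact: lm.
      by apply: cvgM => //; exact: lm.
    apply: cvg_trans; apply: near_eq_cvg; near=> eps.
    have e01 : 0 < eps <= 1 by near: eps; exact: near_unit_interval.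
    have := plevn0 _ e01.
    have := ptilde_neq0 _ e01 nm'' iDn jYi; have := ptilde_neq0 _ e01 nm'' iDn kYi.
    have := ptilde_neq0 _ e01 nm'' kD jYk.
    have := vt _ _ e01 iDn; have := vt _ _ e01 kD.
    rewrite levE /qhat [plev _ _ _ _ _]/= -/(ptilde k (p eps) n).
    by move=> h1 h2 h3 h4 h5 h6; field; rewrite h1 h2 h3 h4 h5 h6.
  (* Case (b): one leg of the path through k is absent, and its mean vanishes with its
     probability. *)
  apply: cvg_trans (lm _ _ iDn jYi); apply: near_eq_cvg; near=> eps.
  have e01 : 0 < eps <= 1 by near: eps; exact: near_unit_interval.
  rewrite levE; move: Nkj; rewrite negb_and => /orP[Nk|Nj].
    have z := ptilde_eq0 _ e01 nm'' iDn kX Nk.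
    by rewrite z (mean_tilde_support _ e01 nm'' iDn kX z) !mul0r !addr0.
  have z := ptilde_eq0 _ e01 nm'' kD jX Nj.
  by rewrite z (mean_tilde_support _ e01 nm'' kD jX z) !mulr0 !addr0.
have /andP[kYi jYk] : (k n.+1 \in Ytilde k p1 n i) && (j \in Ytilde k p1 n (k n.+1)).
  move: jY jYi; rewrite mem_Ylev => /andP[_].
  rewrite (plevS_gt0 _ _ Hk _ (transient_mr_p _ one_in_unit_interval))//.
  by rewrite !mem_Ytilde// jX kX/= => /orP[->|//].
have : mean_t eps n i (k n.+1) /
     (ptilde k (p eps) n i (k n.+1) * vtilde k (p eps) (v eps) n i) +
   (vtilde k (p eps) (v eps) n (k n.+1) / vtilde k (p eps) (v eps) n i) *
   (mean_t eps n (k n.+1) j /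
     (ptilde k (p eps) n (k n.+1) j * vtilde k (p eps) (v eps) n (k n.+1)))
   @[eps --> 0^'+] --> etilde0 k p1 p0 pt0 qh0 w0 F0 n i (k n.+1) +
      fine (w0 n (k n.+1) i) * etilde0 k p1 p0 pt0 qh0 w0 F0 n (k n.+1) j.
  apply: (@cvgD _ R^o); first exact: lm.
  by apply: cvgM => //; exact: lm.
apply: cvg_trans; apply: near_eq_cvg; near=> eps.
have e01 : 0 < eps <= 1 by near: eps; exact: near_unit_interval.
(* Case (c): only the path through k contributes, so p^(n+1)_ij is a product and the means of its
   two legs add up. *)
have z := ptilde_eq0 _ e01 nm'' iDn jX jYi.
rewrite levE z (mean_tilde_support _ e01 nm'' iDn jX z) !add0r.
have := ptilde_neq0 _ e01 nm'' iDn kYi; have := ptilde_neq0 _ e01 nm'' kD jYk.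
have := vt _ _ e01 iDn; have := vt _ _ e01 kD.
by move=> h1 h2 h3 h4; field; rewrite h1 h2 h3 h4.
Unshelve. all: by end_near. Qed.

Lemma mr_E_mean_tilde eps j : 0 < eps <= 1 -> (0 < mb)%N -> j \in D ->
  mr_E (X eps) D (k mb) j = (mean_t eps mb.-1 (k mb) j)%:E.
Proof.
move=> e01 m0 jD; have te := transient_mr_p _ e01.
have kD : k mb \notin D.
  have := @Dbarlev_last _ k D Hk m0 => H.
  by apply: (@Dbarlev_notin _ k D mb.-1); rewrite H finset.set11.
have [h [hE _]] := transient_solve _ _ _ (fun i => p eps i j) te.
(* The system is triangular: h is solved first and then enters the right-hand side for y. *)
have [y [yE _]] := transient_solve _ _ _ (fun i =>
  \sum_(l in (~: D)%SET) mr_mean (X eps) i l * h l + mr_mean (X eps) i j) te.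
have sys : exit_system (~: D)%SET (p eps) (mr_mean (X eps)) j h y.
  by move=> i iD; rewrite {1}hE// {1}yE// [p eps i j + _]addrC.
rewrite (@mr_E_exit_system _ _ _ _ _ _ _ h y te kD jD sys); last first.
  move=> r l rD prl; have := prl; rewrite mr_p_support// => prl1.
  by have [H _ _] := HE _ _ rD prl1; exact: H.
by rewrite (exit_system_last _ _ Hk _ te _ _ _ _ m0 jD sys).
Qed.

End Limits.

Theorem theorem9 (R : realType) (M : nat) (D : {set 'I_M})
    (X : R -> markov_renewal R M) (v : R -> 'I_M -> R)
    (p0 : 'I_M -> 'I_M -> R)
    (F0 : 'I_M -> 'I_M -> cumulativeBounded (0 : R) (1 : R))
    (v0 : 'I_M -> \bar R)
    (k : nat -> 'I_M)
    (pt0 qh0 : nat -> 'I_M -> 'I_M -> R) (w0 : nat -> 'I_M -> 'I_M -> \bar R)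
    (HM : (2 <= M)%N)
    (HD0 : D != finset.set0) (HDT : D != finset.setTfor 'I_M)
    (Hv : forall (eps : R) (i : 'I_M), 0 < eps <= 1 -> i \notin D ->
            1 <= v eps i)
    (* (A) *)
    (HA : forall (eps : R) (i : 'I_M), 0 < eps <= 1 -> mr_F (X eps) i 0 < 1)
    (* (B) *)
    (HB1 : forall i j : 'I_M, i \notin D ->
            (forall eps : R, 0 < eps <= 1 -> 0 < mr_p (X eps) i j) \/
            (forall eps : R, 0 < eps <= 1 -> mr_p (X eps) i j = 0))
    (HB2 : forall i : 'I_M, i \notin D ->
            exists (n : nat) (c : nat -> 'I_M),
              [/\ c 0%N = i,
                  (forall l, (1 <= l < n)%N -> c l \notin D),
                  c n \in D &
                  0 < \prod_(1 <= l < n.+1) mr_p (X 1) (c l.-1) (c l)])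
    (* (C) *)
    (HC : forall i j : 'I_M, i \notin D ->
            mr_p (X eps) i j @[eps --> 0^'+] --> p0 i j)
    (* (D) *)
    (HDF : forall i j : 'I_M, i \notin D -> 0 < mr_p (X 1) i j ->
            weak_cvg_df (fun eps t => mr_Fij (X eps) i j (t * v eps i)) (F0 i j)
            /\ F0 i j 0 < 1)
    (HDv : forall i : 'I_M, i \notin D ->
            (v eps i)%:E @[eps --> 0^'+] --> v0 i /\ (1 <= v0 i)%E)
    (* (E) *)
    (HE : forall i j : 'I_M, i \notin D -> 0 < mr_p (X 1) i j ->
            [/\ (forall eps : R, 0 < eps <= 1 -> (mr_e (X eps) i j < +oo)%E),
                (mr_e (X eps) i j * ((v eps i)^-1)%:E)%E @[eps --> 0^'+]
                  --> df_mean (F0 i j) &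
                (df_mean (F0 i j) < +oo)%E])
    (Hk : enumeration_of k (~: D)%SET)
    (* (i) *)
    (Hi : forall (n : nat) (i j : 'I_M), (n < #|(~: D)%SET|)%N ->
            i \in Dbarlev k D n -> j \in Xlev k n ->
            ptilde k (mr_p (X eps)) n i j @[eps --> 0^'+] --> pt0 n i j /\
            0 <= pt0 n i j <= 1)
    (* (ii) *)
    (Hii : forall (n : nat) (i j : 'I_M), (1 <= n < #|(~: D)%SET|)%N ->
            i \in Dbarlev k D n -> j \in Ylev k (mr_p (X 1)) n i ->
            qhat k (mr_p (X eps)) n i j @[eps --> 0^'+] --> qh0 n i j /\
            0 <= qh0 n i j <= 1)
    (* (iii) *)
    (Hiii : forall (n : nat) (i j : 'I_M), (1 <= n < #|(~: D)%SET|)%N ->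
            i \in Dbarlev k D n.-1 -> j \in Dbarlev k D n.-1 ->
            (vtilde k (mr_p (X eps)) (v eps) n.-1 j /
             vtilde k (mr_p (X eps)) (v eps) n.-1 i)%:E @[eps --> 0^'+]
              --> w0 n.-1 j i /\
            (0 <= w0 n.-1 j i)%E)
    (* (iv) *)
    (Hiv : forall (n : nat) (i : 'I_M), (1 <= n < #|(~: D)%SET|)%N ->
            i \in Dbarlev k D n.-1 -> (w0 n.-1 (k n) i < +oo)%E)
    (j : 'I_M) (Hj : j \in D) :
  let mb := #|(~: D)%SET| in
  let km := k mb in
  let p1 := mr_p (X 1) in
  let E0 := etilde0 k p1 p0 pt0 qh0 w0 F0 mb.-1 km j * pt0 mb.-1 km j in
  let isG (G : cumulative R R) :=
    possibly_improper_df G /\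
    forall s : R, 0 <= s ->
      df_laplace G s =
      (phitilde0 k p1 p0 pt0 qh0 w0 F0 mb.-1 km j s * pt0 mb.-1 km j)%:E in
  [/\ (mr_E (X eps) D km j *
         ((vtilde k (mr_p (X eps)) (v eps) mb.-1 km)^-1)%:E)%E
        @[eps --> 0^'+] --> E0%:E,
      (j \notin Ytilde k p1 mb.-1 km -> E0 = 0),
      (exists G : cumulative R R, isG G) &
      (forall G : cumulative R R, isG G -> df_mean G = E0%:E)].
Proof.
move=> mb km p1 E0 isG.
have HDF' i l : i \notin D -> 0 < mr_p (X 1) i l ->
    weak_cvg_df (fun eps t => mr_Fij (X eps) i l (t * v eps i)) (F0 i l).
  by move=> iD pil; have [] := HDF i l iD pil.
have m0 : (0 < mb)%N.
  rewrite /mb card_gt0; apply: contra HDT => /eqP DC.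
  by rewrite -(finset.setCK D) DC finset.setC0.
have nm : (mb.-1 < mb)%N by rewrite prednK.
have nm' := ltnW nm.
have kD : km \in Dbarlev k D mb.-1 by rewrite (Dbarlev_last k D Hk m0) finset.set11.
have jX : j \in Xlev k mb.-1 by exact: exit_Xlev Hk _ _ nm' Hj.
have [ptc ptb] := Hi _ _ _ nm kD jX.
have pte0 eps : 0 < eps <= 1 -> j \notin Ytilde k p1 mb.-1 km ->
    ptilde k (mr_p (X eps)) mb.-1 km j = 0.
  by move=> e01 jY; exact: (ptilde_eq0 X HB1 HB2 Hk eps e01 nm' kD jX jY).
have pt_eq0 : j \notin Ytilde k p1 mb.-1 km -> pt0 mb.-1 km j = 0.
  move=> jY; rewrite -(cvg_lim _ ptc)//; apply: lim_near_cst => //; near=> eps.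
  by apply: pte0 => //; near: eps; exact: near_unit_interval.
have lm : j \in Ytilde k p1 mb.-1 km ->
    laplace_mean (phitilde0 k p1 p0 pt0 qh0 w0 F0 mb.-1 km j)
                 (etilde0 k p1 p0 pt0 qh0 w0 F0 mb.-1 km j).
  apply: (laplace_mean_loop X p0 F0 pt0 qh0 w0 HB1 HB2 HC Hk Hi nm _ kD) => r l.
  exact: (laplace_mean_lev X v p0 F0 pt0 qh0 w0 Hv HB1 HB2 HC HDF' HE Hk Hi Hii Hiii Hiv nm).
pose mt eps := mean_tilde k (mr_p (X eps)) (mr_mean (X eps)) mb.-1 km j.
pose vt eps := vtilde k (mr_p (X eps)) (v eps) mb.-1 km.
have EE eps : 0 < eps <= 1 ->
    (mr_E (X eps) D km j * ((vt eps)^-1)%:E)%E = (mt eps / vt eps)%:E.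
  by move=> e01; rewrite (mr_E_mean_tilde X v F0 HB1 HB2 HE Hk eps e01 m0 Hj).
split.
- suff : mt eps / vt eps @[eps --> 0^'+] --> E0.
    move=> H; apply: (@cvg_trans _ ((mt eps / vt eps)%:E @[eps --> 0^'+])).
      by apply: near_eq_cvg; near=> eps; rewrite EE//; near: eps; exact: near_unit_interval.
    by apply: cvg_EFin; [exact: nearW | exact: H].
  have [jY|jY] := boolP (j \in Ytilde k p1 mb.-1 km); last first.
    rewrite /E0 pt_eq0// mulr0.
    apply: (@cvg_trans _ ((0 : R) @[_ --> (0 : R)^'+])); last exact: cvg_cst.
    apply: near_eq_cvg; near=> eps.
    have e01 : 0 < eps <= 1 by near: eps; exact: near_unit_interval.
    rewrite /mt (mean_tilde_support X HB1 HB2 Hk eps e01 nm' kD jX) ?mul0r//.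
    exact: pte0.
  (* [mean_tilde_cvg] also divides by the probability of exit at j; multiplying it back gives the
     factor pt0 of the limit. *)
  have : mt eps / (ptilde k (mr_p (X eps)) mb.-1 km j * vt eps) *
      ptilde k (mr_p (X eps)) mb.-1 km j @[eps --> 0^'+] --> E0.
    apply: cvgM => //.
    apply: (mean_tilde_cvg X v p0 F0 pt0 qh0 w0 Hv HB1 HB2 HC Hk Hi nm _ kD jY) => r l.
    exact: (mean_lev_cvg X v p0 F0 pt0 qh0 w0 Hv HB1 HB2 HC HE Hk Hi Hii Hiii Hiv nm).
  apply: cvg_trans; apply: near_eq_cvg; near=> eps.
  have e01 : 0 < eps <= 1 by near: eps; exact: near_unit_interval.
  have ptn0 := ptilde_neq0 X HB1 HB2 Hk eps e01 nm' kD jY.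
  have cancel (m w q : R) : q != 0 -> m / (q * w) * q = m / w.
    by move=> q0; rewrite -mulrA invfM mulrAC mulVf ?mul1r.
  exact: cancel.
- by move=> /pt_eq0 pt0E; rewrite /E0 pt0E mulr0.
- have [jY|jY] := boolP (j \in Ytilde k p1 mb.-1 km); last first.
    (* Off [Ytilde] the factor pt0 is 0, so the required transform is zero and any phi can be scaled
       by 0; the constant 1 is taken. *)
    have [G GE] := laplace_df_exists (fun=> 1) _ is_laplace1 erefl ptb.
    exists G; move: GE; rewrite /isG pt_eq0// => -[Gi GE]; split => // s s0.
    by rewrite GE// !mulr0.
  have [lphi phi0 _] := lm jY.
  exact: laplace_df_exists lphi phi0 ptb.
- move=> G [_ GE].
  have [jY|jY] := boolP (j \in Ytilde k p1 mb.-1 km).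
    exact: df_mean_laplace (lm jY) GE.
  rewrite /E0 pt_eq0// mulr0.
  (* The zero transform is written as 0 times the transform of the exponential law of mean 0. *)
  rewrite (@df_mean_laplace _ G _ _ 0 (laplace_mean_exponential 0 (lexx _))) ?mulr0//.
  by move=> s s0; rewrite GE// pt_eq0// !mulr0.
Unshelve. all: by end_near. Qed.
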